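(* Let $\rho:S\to[0,\infty)$. For all $t>0$, $n\ge1$ and $x_1,\dots,x_n\in S$, $$\int\mathbb E^{BMP}_\eta D\Big(\sum_{i=1}^n\delta_{x_i},\eta_t\Big)\mu_\rho(d\eta)\ \ge\ \prod_{i=1}^n\int\mathbb E^{BMP}_\eta\big(D(\delta_{x_i},\eta_t)\big)\mu_\rho(d\eta).$$ In particular, for all choices of $\rho$ and $t>0$, the variables $\{\eta_x^2:x\in S\}$ are positively correlated under the law at time $t$ of the Brownian momentum process started from $\mu_\rho$.
   Context: $S$ is either a finite set or $S=\mathbb Z^d$. $p(x,y)$ is an irreducible symmetric random walk transition probability on $S$: $p(x,y)=p(y,x)\ge 0$, $\sum_y p(x,y)=1$, $p(x,x)=0$. If $S=\mathbb Z^d$, $p$ is moreover translation invariant and of finite range: $p(x,y)=\pi(y-x)$ and there is $R>0$ with $p(x,y)=0$ for $|x-y|>R$. The Brownian momentum process (BMP) is the system of interacting diffusions defined as the Markov process $(\eta_t)_{t\ge0}$ on $X=\mathbb R^S$ via the formal generator on local functions $$L_{BMP}f(\eta)=\Big(\sum_{x,y\in S}p(x,y)\Big(\eta_x\frac{\partial}{\partial\eta_y}-\eta_y\frac{\partial}{\partial\eta_x}\Big)^2\Big)f(\eta).$$ $\mathbb E^{BMP}_\eta$ is expectation for the process started from $\eta$. For a finite particle configuration $\xi\in\mathbb N^S$ (where $\mathbb N$ includes $0$), $\sum_x\xi_x<\infty$, and $\eta\in X$, $$D(\xi,\eta)=\prod_{x\in S}\frac{\eta_x^{2\xi_x}}{(2\xi_x-1)!!}\qquad((-1)!!=1).$$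 $\sum_{i=1}^n\delta_{x_i}$ denotes the particle configuration $\xi$ obtained by putting a particle at each $x_i$, i.e. $\xi(x)=\sum_{i=1}^nI(x_i=x)$. $\mu_\rho=\otimes_{x\in S}\nu_{\rho(x)}(d\eta_x)$, where $\nu_{\rho(x)}$ is the Gaussian measure on $\mathbb R$ with mean zero and variance $\rho(x)$ (for $\rho(x)=0$, the Dirac mass at $0$). *)

(* Defs.v *)
From HB Require Import structures.
From mathcomp Require Import all_boot all_order all_algebra finmap.
From mathcomp Require Import all_classical all_reals all_analysis measurable_realfun.

Set Implicit Arguments.
Unset Strict Implicit.
Unset Printing Implicit Defensive.

Import Order.TTheory GRing.Theory Num.Def Num.Theory.
Import numFieldNormedType.Exports.

Local Open Scope classical_set_scope.
Local Open Scope ring_scope.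

Inductive site_space := FiniteSites of finType | Lattice of nat.

Definition sites (s : site_space) : countType :=
  match s with FiniteSites T => T | Lattice d => 'rV[int]_d end.

Section RandomWalk.
Variable R : realType.

Definition irreducible (S : countType) (p : S -> S -> R) : Prop :=
  forall x y, exists s : seq S,
    path (fun u v => 0 < p u v) x s /\ last x s = y.

Record symmetric_walk (S : countType) (p : S -> S -> R) : Prop := {
  walk_sym : forall x y, p x y = p y x;
  walk_ge0 : forall x y, 0 <= p x y;
  walk_sum1 : forall x, \esum_(y in [set: S]) (p x y)%:E = 1%E;
  walk_diag : forall x, p x x = 0;
  walk_irreducible : irreducible p }.

Definition euclid_norm d (z : 'rV[int]_d) : R :=
  Num.sqrt (\sum_i ((z 0 i)%:~R ^+ 2)).

Definition translation_invariant d (p : 'rV[int]_d -> 'rV[int]_d -> R) :=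
  exists pi_ : 'rV[int]_d -> R, forall x y, p x y = pi_ (y - x).

Definition finite_range d (p : 'rV[int]_d -> 'rV[int]_d -> R) :=
  exists r : R, 0 < r /\ forall x y, r < euclid_norm (x - y) -> p x y = 0.

Definition admissible (s : site_space) (p : sites s -> sites s -> R) : Prop :=
  symmetric_walk p /\
  match s return (sites s -> sites s -> R) -> Prop with
  | FiniteSites _ => fun _ => True
  | Lattice d => fun q => @translation_invariant d q /\ @finite_range d q
  end p.

End RandomWalk.

Section Configurations.
Variables (R : realType) (S : countType).

Definition cylinders : set (set (S -> R)) :=
  [set A | exists x (B : set (measurableTypeR R)),
     measurable B /\ A = [set eta | B (eta x)]].

(* R^S with its product sigma-algebra *)
Definition conf := g_sigma_algebraType cylinders.

Definition upd (eta : conf) (x : S) (a : R) : conf :=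
  fun y => if y == x then a else eta y.

Definition slice (x : S) (f : conf -> R) (eta : conf) : R -> R :=
  fun a => f (upd eta x a).

Definition partial (x : S) (f : conf -> R) : conf -> R :=
  fun eta => derive1 (slice x f eta) (eta x).

Definition iter_partial (s : seq S) (f : conf -> R) : conf -> R :=
  foldr partial f s.

(* Smooth functions of finitely many coordinates all of whose derivatives have
   polynomial growth.  Local boundedness of the derivatives of every order
   makes them continuous. *)
Definition smooth_local (f : conf -> R) : Prop :=
  exists A : seq S,
    (forall eta zeta : conf, {in A, eta =1 zeta} -> f eta = f zeta) /\
    forall s : seq S,
      (forall x eta, derivable (slice x (iter_partial s f) eta) (eta x) 1) /\
      exists (C : R) (k : nat), forall eta : conf,
        `|iter_partial s f eta| <= C * (1 + \sum_(x <- A) `|eta x|) ^+ k.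

Definition rot (x y : S) (f : conf -> R) : conf -> R :=
  fun eta => eta x * partial y f eta - eta y * partial x f eta.

(* The sum has finite support for local f and p of finite range (or S
   finite); outside this case the finitely supported sum is a junk value. *)
Definition gen_BMP (p : S -> S -> R) (f : conf -> R) : conf -> R :=
  fun eta => \sum_(xy \in [set: S * S])
    p xy.1 xy.2 * rot xy.1 xy.2 (rot xy.1 xy.2 f) eta.

(* k |-> (2 k - 1)!!, with (-1)!! = 1 *)
Definition odd_dfact (k : nat) : nat := (\prod_(i < k) (2 * i + 1))%N.

(* For xi of finite support all but finitely many factors are 1. *)
Definition D (xi : S -> nat) (eta : conf) : R :=
  \big[*%R/1]_(x \in [set: S])
    (eta x ^+ (2 * xi x)%N / (odd_dfact (xi x))%:R).

Definition delta (x : S) : S -> nat := fun y => (x == y : nat).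

Definition particles n (x : 'I_n -> S) : S -> nat :=
  fun y => (\sum_(i < n) delta (x i) y)%N.

(* [normal_prob] takes the standard deviation. *)
Definition gaussian (v : R) (A : set (measurableTypeR R)) : \bar R :=
  if v == 0 then \d_(0 : R) A else normal_prob 0 (Num.sqrt v) A.

Definition product_gaussian (rho : S -> R) (mu : probability conf R) : Prop :=
  forall (F : {fset S}) (B : S -> set (measurableTypeR R)),
    (forall x, measurable (B x)) ->
    mu [set eta | forall x, x \in F -> B x (eta x)] =
    (\prod_(x <- F) gaussian (rho x) (B x))%E.

End Configurations.

Section Process.
Variables (R : realType) (S : countType).
Local Notation X := (conf R S).
Variables (d : measure_display) (Omega : measurableType d).
Variables (Pr : X -> probability Omega R) (eta_ : R -> {mfun Omega >-> X}).

Definition past (s : R) : set (set Omega) :=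
  <<s [set C | exists (u : R) (A : set X),
        [/\ 0 <= u <= s, measurable A & C = eta_ u @^-1` A] ]>>.

(* [Pr] is the family of laws (P_eta) of the coordinate process [eta_], and
   [X0] is the set of configurations from which the process is started: on an
   infinite S the formal generator does not define a process from every
   element of R^S (energy may arrive from infinity), so X0 need not be all
   of R^S.  For eta outside X0 nothing is required of P_eta. *)
Record BMP (p : S -> S -> R) (X0 : set X) : Prop := {
  BMP_states : measurable X0;
  BMP_kernel : forall C : set Omega, measurable C ->
    measurable_fun [set: X] (fun eta => Pr eta C);
  BMP_start : forall eta, X0 eta -> forall A : set X, measurable A ->
    Pr eta (eta_ 0 @^-1` A) = \d_eta A;
  BMP_stay : forall eta, X0 eta -> forall t : R, 0 <= t ->
    Pr eta (eta_ t @^-1` X0) = 1%E;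
  BMP_markov : forall eta, X0 eta -> forall s t : R, 0 <= s -> 0 <= t ->
    forall (C : set Omega) (A : set X), past s C -> measurable A ->
    Pr eta (C `&` eta_ (s + t) @^-1` A) =
    (\int[Pr eta]_(w in C) Pr (eta_ s w) (eta_ t @^-1` A))%E;
  BMP_integrable : forall eta, X0 eta -> forall f, smooth_local f ->
    forall t : R, 0 <= t ->
    (Pr eta).-integrable [set: Omega] (fun w => (f (eta_ t w))%:E) /\
    lebesgue_measure.-integrable `[0, t]
      (fun s => 'E_(Pr eta)[gen_BMP p f \o eta_ s]%E);
  BMP_generator : forall eta, X0 eta -> forall f, smooth_local f ->
    forall t : R, 0 <= t ->
    ('E_(Pr eta)[f \o eta_ t] =
     (f eta)%:E + \int[lebesgue_measure]_(s in `[0%R, t])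
                    'E_(Pr eta)[gen_BMP p f \o eta_ s])%E }.

End Process.

Section Mixture.
Context d1 d2 (X : measurableType d1) (Omega : measurableType d2)
  (R : realType).
Variables (mu : probability X R) (Pr : X -> probability Omega R).
Variable mPr : forall C : set Omega, measurable C ->
  measurable_fun [set: X] (fun eta => Pr eta C).

(* The law P_mu of the process with initial distribution mu; the measurability
   proof is an argument only so that the measure structure can be attached. *)
Definition mixture of (forall C : set Omega, measurable C ->
    measurable_fun [set: X] (fun eta => Pr eta C)) : set Omega -> \bar R :=
  fun C => (\int[mu]_eta Pr eta C)%E.

Let mixture0 : mixture mPr set0 = 0%E.
Proof. by apply: integral0_eq => y _; rewrite measure0. Qed.

Let mixture_ge0 C : (0 <= mixture mPr C)%E.
Proof. by apply: integral_ge0 => y _; exact: measure_ge0. Qed.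

Let mixture_sigma_additive : semi_sigma_additive (mixture mPr).
Proof.
move=> F mF tF mUF; rewrite /mixture.
rewrite (_ : (fun n => _) = fun n =>
    (\int[mu]_eta (\sum_(0 <= i < n) Pr eta (F i)))%E); last first.
  apply/funext => n; rewrite ge0_integral_sum// => i.
  exact: mPr.
rewrite [X in _ --> X](_ : _ =
   (\int[mu]_eta (limn (fun n => \sum_(0 <= i < n) Pr eta (F i))))%E); last first.
  apply: eq_integral => eta _; apply/esym/cvg_lim => //.
  exact: measure_semi_sigma_additive.
apply: cvg_monotone_convergence => //.
- by move=> n; apply: emeasurable_sum => i; exact: mPr.
- by move=> n eta _; apply: sume_ge0.
- move=> eta _ m n mn; exact: lee_sum_nneg_natr.
Qed.

HB.instance Definition _ := isMeasure.Build _ _ _ (mixture mPr)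
  mixture0 mixture_ge0 mixture_sigma_additive.

Let mixture_setT : mixture mPr [set: Omega] = 1%:E.
Proof.
rewrite /mixture (eq_integral (cst 1%E)); last first.
  by move=> y _; exact: probability_setT.
by rewrite integral_cst// mul1e; exact: probability_setT.
Qed.

HB.instance Definition _ := Measure_isProbability.Build _ _ _
  (mixture mPr) mixture_setT.

End Mixture.

(* The first clause makes sense for nonnegative variables without moment
   assumption; the second one is positivity of the covariance whenever the
   latter is defined. *)
Definition positively_correlated d (T : measurableType d) (R : realType)
    (P : probability T R) (I : Type) (Y : I -> T -> R) : Prop :=
  forall i j,
    ('E_P[Y i] * 'E_P[Y j] <= 'E_P[(Y i \* Y j)%R])%E /\
    (Y i \in Lfun P 1 -> Y j \in Lfun P 1 -> (Y i \* Y j) \in Lfun P 1 ->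
     (0 <= covariance P (Y i) (Y j))%E).

Definition law_at (R : realType) (S : countType) d (Omega : measurableType d)
    (Pr : conf R S -> probability Omega R)
    (eta_ : R -> {mfun Omega >-> conf R S}) (p : S -> S -> R)
    (X0 : set (conf R S)) (bmp : BMP Pr eta_ p X0)
    (mu : probability (conf R S) R) (t : R) : probability (conf R S) R :=
  distribution (mixture mu (BMP_kernel bmp)) (eta_ t).

(* Main.v *)
(* By duality, the D-moments of n labelled particles started from a fixed eta
   solve the linear equation of the symmetric inclusion process (SIP).
   A nonnegative solution of v' = G v with a positive jump operator G is
   absolutely monotone in time, hence equal to its Taylor series (uniqueness in
   the style of Bernstein and Widder): no growth condition is needed on the
   lattice, and rho may be unbounded.  Integrating over mu_rho turns the initial
   data into prod_i rho (x_i), so the claim compares the SIP with independent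
   walks applied to a product function h (x_1) ... h (x_n).  Such products of
   solutions of the walk equation are subsolutions for the SIP, since the extra
   attraction contributes p (x_i, x_j) (h (x_i) - h (x_j))^2 >= 0 per pair. *)
Require Import Defs.
From HB Require Import structures.
From mathcomp Require Import all_boot all_order all_algebra finmap.
From mathcomp Require Import all_classical all_reals all_analysis measurable_realfun.
From mathcomp Require Import giry zify ring lra.

Set Implicit Arguments.
Unset Strict Implicit.
Unset Printing Implicit Defensive.

Import Order.TTheory GRing.Theory Num.Def Num.Theory.
Import numFieldNormedType.Exports.

Local Open Scope classical_set_scope.
Local Open Scope ring_scope.

(** * Jump operators and flows *)

(** Finiteness of the integrated moments is not established for unbounded [rho], so no differential
    equation is written for them. The two sides are treated asymmetrically instead. For n particles
    only a lower bound goes under the integral: each Taylor polynomial is a finite positive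
    combination of values [D (particles z) eta], whose integrals are finite and explicit. For one
    particle the whole series is needed; its partial sums increase, so monotone convergence applies.
    What remains is a comparison between Taylor polynomials of two deterministic equations. That
    comparison needs a subsolution bounded uniformly in space, which is what makes its Taylor
    remainder vanish. Hence [rho] is cut off at a constant, and the cut-off is removed at a fixed
    Taylor order. Constants: the sum over ordered pairs, with [p] symmetric, gives each particle a
    walk rate 4 p and an extra rate 8 p towards the site of each other particle. Null jumps fill the
    attraction up to 8 n^2. The total rates are thus 4 for a walk and 4 n + 8 n^2 for the SIP, and
    the factor expR (8 n^2 t) reconciles the two exponential prefactors. *)

Section JumpOperator.
Context {R : realType} {E : Type}.
Variable G : E -> seq (R * E).
Hypothesis G_ge0 : forall x, all (fun r : R * E => 0 <= r.1) (G x).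
Implicit Types (v w : E -> R) (x : E).

(** Only the gain part of a generator is kept. In the applications the loss term has a constant rate
    and is removed by an exponential factor, which leaves a positive operator. *)
Definition jump v x : R := \sum_(r <- G x) r.1 * v r.2.

Definition taylor N (t : R) v x : R :=
  \sum_(k < N) t ^+ k / k`!%:R * iter k jump v x.

Lemma jump_le v w : (forall x, v x <= w x) -> forall x, jump v x <= jump w x.
Proof.
move=> vw x; rewrite /jump; have := G_ge0 x.
elim: (G x) => [|r s IH] /=; first by rewrite !big_nil.
by move=> /andP[r0 /IH IHs]; rewrite !big_cons lerD// ler_wpM2l.
Qed.

Lemma iter_jump_le k v w :
  (forall x, v x <= w x) -> forall x, iter k jump v x <= iter k jump w x.
Proof. by move=> vw; elim: k => //= k IH; exact: jump_le. Qed.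

Lemma jump_cst0 x : jump (fun=> 0) x = 0.
Proof. by rewrite /jump big1// => r _; rewrite mulr0. Qed.

Lemma jump_ge0 v : (forall x, 0 <= v x) -> forall x, 0 <= jump v x.
Proof. by move=> v0 x; rewrite -(jump_cst0 x); exact: jump_le. Qed.

Lemma iter_jump_ge0 k v :
  (forall x, 0 <= v x) -> forall x, 0 <= iter k jump v x.
Proof. by move=> v0; elim: k => //= k IH; exact: jump_ge0. Qed.

Lemma jumpD v w x : jump (fun z => v z + w z) x = jump v x + jump w x.
Proof.
by rewrite /jump -big_split; apply: eq_bigr => r _; rewrite mulrDr.
Qed.

Lemma jumpZ c v x : jump (fun z => c * v z) x = c * jump v x.
Proof. by rewrite /jump mulr_sumr; apply: eq_bigr => r _; rewrite mulrCA. Qed.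

Lemma jump_sum I (s : seq I) (v : I -> E -> R) x :
  jump (fun z => \sum_(i <- s) v i z) x = \sum_(i <- s) jump (v i) x.
Proof.
by rewrite /jump exchange_big; apply: eq_bigr => r _; rewrite mulr_sumr.
Qed.

Lemma jump_taylor N t v x :
  jump (taylor N t v) x = \sum_(k < N) t ^+ k / k`!%:R * iter k.+1 jump v x.
Proof. by rewrite jump_sum; apply: eq_bigr => k _; rewrite jumpZ. Qed.

Lemma taylorS N t v x :
  taylor N.+1 t v x = taylor N t v x + t ^+ N / N`!%:R * iter N jump v x.
Proof. by rewrite /taylor big_ord_recr. Qed.

Lemma taylor_at0 N v x : taylor N.+1 0 v x = v x.
Proof.
rewrite /taylor big_ord_recl expr0 divr1 mul1r big1 ?addr0// => k _.
by rewrite expr0n/= mul0r mul0r.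
Qed.

Lemma taylor_ge0 N t v x : 0 <= t -> (forall x, 0 <= v x) ->
  0 <= taylor N t v x.
Proof.
move=> t0 v0; apply: sumr_ge0 => k _.
by rewrite mulr_ge0 ?iter_jump_ge0// divr_ge0// exprn_ge0.
Qed.

Lemma is_derive_pow_fact k (t : R) :
  is_derive t (1 : R) (fun s : R => s ^+ k.+1 / k.+1`!%:R) (t ^+ k / k`!%:R).
Proof.
have -> : (fun s : R => s ^+ k.+1 / k.+1`!%:R) =
    (k.+1`!%:R)^-1 *: (@id R) ^+ k.+1.
  by apply/funext => s; rewrite exprfctE/= mulrC.
apply: is_derive_eq.
rewrite /GRing.scale/= mulr1 factS natrM invfM.
by field; rewrite nat1r !pnatr_eq0 -lt0n fact_gt0.
Qed.

Lemma is_derive_taylor N t v x :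
  is_derive t (1 : R) (fun s : R => taylor N.+1 s v x) (jump (taylor N t v) x).
Proof.
rewrite jump_taylor.
have -> : (fun s : R => taylor N.+1 s v x) =
  (cst (v x) + \sum_(k < N) (fun s : R => iter k.+1 jump v x *: (s ^+ k.+1 / k.+1`!%:R))).
  apply/funext => s; rewrite /taylor big_ord_recl expr0 divr1 mul1r.
  rewrite /GRing.add/= fct_sumE; congr (_ + _); apply: eq_bigr => k _.
  by rewrite /GRing.scale/= mulrC.
rewrite -[X in is_derive _ _ _ X]add0r; apply: is_deriveD.
apply: is_derive_sum => k.
rewrite mulrC.
apply: is_deriveZ; exact: is_derive_pow_fact.
Qed.

End JumpOperator.

Lemma is_derive_continuous {R : realType} (f : R -> R) (t d : R) :
  is_derive t 1 f d -> {for t, continuous f}.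
Proof. by move=> [df _]; apply/differentiable_continuous/derivable1_diffP. Qed.

Section MonotoneFlow.
Context {R : realType}.

Lemma is_derive_ge0_le (f df : R -> R) (T : R) : 0 <= T ->
  {within `[0, T], continuous f} ->
  (forall t, 0 < t < T -> is_derive t 1 f (df t)) ->
  (forall t, 0 < t < T -> 0 <= df t) -> f 0 <= f T.
Proof.
move=> T0 cf ddf df0.
apply: (@ger0_derive1_ndecr _ _ 0 T) => // t; rewrite in_itv/= => tT.
  by have [] := ddf _ tT.
by rewrite derive1E; have [_ ->] := ddf _ tT; exact: df0.
Qed.

(** [dy] is separate from [y] so that the same notion serves solutions, subsolutions and
    supersolutions. Only continuity is asked at the end points: nothing controls the process at
    negative times. *)
Definition flow {E : Type} (T : R) (y dy : R -> E -> R) : Prop :=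
  forall x, {within `[0, T], continuous (y ^~ x)} /\
    forall t, 0 < t < T -> is_derive t 1 (y ^~ x) (dy t x).

Lemma flowS {E : Type} (T T' : R) (y dy : R -> E -> R) : T' <= T ->
  flow T y dy -> flow T' y dy.
Proof.
move=> TT' fy x; have [cy dyx] := fy x; split.
  by apply: continuous_subspaceW cy; apply: subset_itvl; rewrite bnd_simp.
by move=> t /andP[t0 tT]; apply: dyx; rewrite t0 (lt_le_trans tT).
Qed.

Context {E : Type} (G : E -> seq (R * E)).
Hypothesis G_ge0 : forall x, all (fun r : R * E => 0 <= r.1) (G x).
Variables (T : R) (y dy : R -> E -> R).
Hypothesis fy : flow T y dy.

(** The derivative of [y] minus the polynomial of order [N.+1] is at least [jump G] of [y] minus the
    polynomial of order [N], which is nonnegative by induction. Nonnegativity of [y] is the case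
    [N = 0]. *)
Lemma taylor_lower : (forall t x, 0 <= t <= T -> 0 <= y t x) ->
  (forall t x, 0 < t < T -> jump G (y t) x <= dy t x) ->
  forall N t x, 0 <= t <= T -> taylor G N t (y 0) x <= y t x.
Proof.
move=> y0 dy0; elim=> [|N IH] t x tT.
  by rewrite /taylor big_ord0 y0.
have /andP[t0 tT'] := tT.
have [cy dyx] := flowS tT' fy x.
pose f s := y s x - taylor G N.+1 s (y 0) x.
have : f 0 <= f t.
  apply: (@is_derive_ge0_le _ (fun s => dy s x - jump G (taylor G N s (y 0)) x)) => //.
  - move=> s; apply: cvgB; first exact: cy.
    move: s; apply: continuous_subspaceT => s.
    exact: is_derive_continuous (is_derive_taylor G N s (y 0) x).
  - move=> s st; apply: is_deriveB; first exact: dyx.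
    exact: is_derive_taylor.
  - move=> s /andP[s0 st]; rewrite subr_ge0.
    rewrite (le_trans (jump_le _ (v:=_) (w:=y s) _ _))//.
      by move=> z; apply: IH; rewrite ltW//= (le_trans (ltW st)).
    by rewrite dy0// s0 (lt_le_trans st).
by rewrite /f taylor_at0 subrr subr_ge0.
Qed.

(** The induction of [taylor_lower] run from above: [b] starts it, and each integration in time
    turns one remainder into the next. *)
Lemma taylor_upper (b : E -> R) : (forall t x, 0 <= t <= T -> y t x <= b x) ->
  (forall t x, 0 < t < T -> dy t x <= jump G (y t) x) ->
  forall N t x, 0 <= t <= T ->
  y t x <= taylor G N t (y 0) x + t ^+ N / N`!%:R * iter N (jump G) b x.
Proof.
move=> yb dy0; elim=> [|N IH] t x tT.
  by rewrite /taylor big_ord0 add0r expr0 divr1 mul1r yb.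
have /andP[t0 tT'] := tT.
have [cy dyx] := flowS tT' fy x.
pose f s := taylor G N.+1 s (y 0) x +
  iter N.+1 (jump G) b x *: (s ^+ N.+1 / N.+1`!%:R) - y s x.
have : f 0 <= f t.
  apply: (@is_derive_ge0_le _ (fun s => jump G (taylor G N s (y 0)) x +
      iter N.+1 (jump G) b x *: (s ^+ N / N`!%:R) - dy s x)) => //.
  - move=> s; apply: cvgB; last exact: cy.
    move: s; apply: continuous_subspaceT => s.
    apply: is_derive_continuous; apply: is_deriveD.
      exact: is_derive_taylor.
    exact: is_deriveZ (is_derive_pow_fact N s).
  - move=> s st; apply: is_deriveB; last exact: dyx.
    apply: is_deriveD; first exact: is_derive_taylor.
    apply: is_deriveZ; exact: is_derive_pow_fact.
  - move=> s /andP[s0 st]; rewrite subr_ge0.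
    rewrite (le_trans (dy0 _ _ _))//.
      by rewrite s0 (lt_le_trans st).
    rewrite /GRing.scale/= mulrC -jumpZ -jumpD; apply: jump_le => // z.
    by apply: IH; rewrite ltW//= (le_trans (ltW st)).
rewrite /f taylor_at0 expr0n/= mul0r scaler0 addr0 subrr subr_ge0.
by rewrite /GRing.scale/= [X in _ + X]mulrC.
Qed.

End MonotoneFlow.

(** * Series expansion of nonnegative solutions *)

Section NonnegativeFlow.
Context {R : realType} {E : Type} (G : E -> seq (R * E)).
Hypothesis G_ge0 : forall x, all (fun r : R * E => 0 <= r.1) (G x).

(** Allows the Taylor expansion to be restarted at a positive time, which is an interior point of
    the original flow. *)
Lemma flow_shift (T s : R) (y dy : R -> E -> R) : 0 < s ->
  (forall T', flow T' y dy) ->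
  flow T (fun t => y (t + s)) (fun t => dy (t + s)).
Proof.
move=> s0 fy x.
have dsh (t : R) : is_derive t (1 : R) (fun r : R => r + s) 1.
  rewrite (_ : (fun r : R => r + s) = (@id R) + cst s)//.
  rewrite -[X in is_derive _ _ _ X]addr0; exact: is_deriveD.
have D (t : R) : 0 <= t -> is_derive t 1 (fun r => y (r + s) x) (dy (t + s) x).
  move=> t0; have [_ /(_ (t + s)) dyx] := fy (t + s + 1) x.
  have /dyx dyts : 0 < t + s < t + s + 1 by rewrite ltr_wpDl//= ltrDl.
  have := @is_derive1_comp _ (y ^~ x) (fun r => r + s) t _ _ dyts (dsh t).
  by rewrite mulr1.
split; last by move=> t /andP[/ltW/D].
apply: derivable_within_continuous => t; rewrite in_itv/= => /andP[t0 _].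
by have [] := D t t0.
Qed.

Variable y : R -> E -> R.
Hypothesis y_ge0 : forall t x, 0 <= t -> 0 <= y t x.
Hypothesis fy : forall T, flow T y (fun t => jump G (y t)).

Lemma nonneg_flow_ndecr t T x : 0 <= t <= T -> y t x <= y T x.
Proof.
move=> /andP[t0 tT]; have [cy dyx] := fy T x.
apply: (@ger0_derive1_ndecr _ (y ^~ x) 0 T) => // s; rewrite in_itv/= => sT.
  by have [] := dyx _ sT.
rewrite derive1E; have [_ ->] := dyx _ sT.
by apply: jump_ge0 => // z; apply: y_ge0; case/andP: sT => /ltW.
Qed.

(* Along the flow every coordinate is absolutely monotone in time; as in
   Bernstein's theorem, comparing the remainder at [t] with the expansion from
   [t] to [3 t] forces convergence, with no growth condition on [y]. *)
Lemma nonneg_flow_series t x : 0 <= t ->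
  taylor G N t (y 0) x @[N --> \oo] --> y t x.
Proof.
rewrite le_eqVlt => /predU1P[<-|t0].
  rewrite -(cvg_shiftS _).
  by under eq_fun do rewrite taylor_at0; exact: cvg_cst.
pose z s := y (s + t).
have z0 s v : 0 <= s -> 0 <= z s v by move=> s0; rewrite y_ge0// addr_ge0// ltW.
have fz T : flow T z (fun s => jump G (z s)) by exact: (flow_shift T t0 fy).
(* Since [y] is nondecreasing in time, the remainder at [t] is at most t^N / N! times
   [iter N (jump G) (y t) x]. The same iterate with weight (2 t)^N / N! is one term of the
   nonnegative expansion restarted at [t] and read at 3 t; the ratio of the weights is 2^-N. *)
have H N : `|y t x - taylor G N t (y 0) x| <= (2^-1) ^+ N * y (2 * t + t) x.
  rewrite ger0_norm; last first.
    rewrite subr_ge0; apply: (taylor_lower G_ge0 (fy t)) => //.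
    - by move=> s v /andP[/y_ge0].
    - by rewrite lexx ltW.
  have up : y t x - taylor G N t (y 0) x <=
      t ^+ N / N`!%:R * iter N (jump G) (y t) x.
    rewrite lerBlDl; apply: (taylor_upper G_ge0 (fy t)) => //.
    - by move=> s v; exact: nonneg_flow_ndecr.
    - by rewrite lexx ltW.
  apply: (le_trans up).
  have lo : taylor G N.+1 (2 * t) (z 0) x <= z (2 * t) x.
    apply: (taylor_lower G_ge0 (fz (2 * t))) => //.
    - by move=> s v /andP[/z0].
    - by rewrite lexx mulr_ge0// ltW.
  rewrite exprVn [leRHS]mulrC ler_pdivlMr ?exprn_gt0//.
  apply: le_trans lo; rewrite taylorS /z add0r exprMn.
  rewrite -[leLHS]add0r lerD//.
    by apply: taylor_ge0 => // [|v]; [rewrite mulr_ge0// ltW|exact/y_ge0/ltW].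
  by rewrite le_eqVlt; apply/orP; left; apply/eqP; ring.
apply/cvgrPdist_le => /= e e0.
have : (2^-1) ^+ N * y (2 * t + t) x @[N --> \oo] --> 0.
  rewrite -[X in _ --> X](mul0r (y (2 * t + t) x)).
  apply: cvgMr_tmp; apply: cvg_expr.
  by rewrite ger0_norm// invf_lt1// ltr1n.
move=> /cvgrPdist_le /(_ e e0); apply: filterS => N.
rewrite sub0r normrN => h; apply: (le_trans (H N)); apply: le_trans h.
exact: ler_norm.
Qed.

End NonnegativeFlow.

(** * Bounded subsolutions *)

Section BoundedFlow.
Context {R : realType} {E : Type} (G : E -> seq (R * E)).
Hypothesis G_ge0 : forall x, all (fun r : R * E => 0 <= r.1) (G x).
Variable c : R.
Hypothesis G_sum : forall x, \sum_(r <- G x) r.1 = c.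

Lemma iter_jump_cst N (b : R) x : iter N (jump G) (fun=> b) x = c ^+ N * b.
Proof.
elim: N x => [|N IH] x; first by rewrite expr0 mul1r.
rewrite iterS (_ : iter N _ _ = fun=> c ^+ N * b); last exact/funext.
by rewrite /jump -mulr_suml G_sum exprS mulrA.
Qed.

(** Jumps of total rate [c] multiply constants by [c], so the remainder in [taylor_upper] is the
    N-th term of an exponential series times [b] and tends to 0. *)
Lemma bounded_subflow_le (T b M : R) (y dy : R -> E -> R) x : 0 <= T ->
  flow T y dy -> (forall t z, 0 <= t <= T -> y t z <= b) ->
  (forall t z, 0 < t < T -> dy t z <= jump G (y t) z) ->
  (forall N, taylor G N T (y 0) x <= M) -> y T x <= M.
Proof.
move=> T0 fy yb dyG HM.
have H N : y T x <= M + exp_coeff (T * c) N * b.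
  have TT : 0 <= T <= T by rewrite lexx T0.
  apply: le_trans (taylor_upper G_ge0 fy (b := fun=> b) yb dyG N x TT) _.
  rewrite lerD// iter_jump_cst /exp_coeff/= exprMn.
  by rewrite le_eqVlt; apply/orP; left; apply/eqP; ring.
have : M + exp_coeff (T * c) N * b @[N --> \oo] --> M + 0 * b.
  apply: cvgD; first exact: cvg_cst.
  apply: cvgMr_tmp; apply: cvg_series_cvg_0; exact: is_cvg_series_exp_coeff.
rewrite mul0r addr0 => cvM.
rewrite -(cvg_lim _ cvM)//; apply: limr_ge; first by apply/cvg_ex; exists M.
exact: nearW.
Qed.

End BoundedFlow.

(** * Duality from a fixed configuration *)

Section DualityFlow.
Context {R : realType} {S : countType} {dO : measure_display}.
Context {Omega : measurableType dO}.
Context {Pr : conf R S -> probability Omega R}.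
Context {eta_ : R -> {mfun Omega >-> conf R S}} {p : S -> S -> R}.
Context {X0 : set (conf R S)}.
Hypothesis bmp : BMP Pr eta_ p X0.
Context {E : Type} (f : E -> conf R S -> R) (G : E -> seq (R * E)) (c : R).
Hypothesis f_smooth : forall x, smooth_local (f x).
Hypothesis f_ge0 : forall x zeta, 0 <= f x zeta.
Hypothesis f_dual : forall x zeta,
  gen_BMP p (f x) zeta = jump G (fun z => f z zeta) x - c * f x zeta.
Variable eta : conf R S.
Hypothesis eta_X0 : X0 eta.
Local Notation mu := (@lebesgue_measure R).

Let u (t : R) (x : E) : R := fine ('E_(Pr eta)[f x \o eta_ t])%E.
Let g (t : R) (x : E) : R := jump G (u t) x - c * u t x.

Let dual_integrable t x : 0 <= t ->
  (Pr eta).-integrable [set: Omega] (fun w => (f x (eta_ t w))%:E).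
Proof. by move=> t0; have [] := BMP_integrable bmp eta_X0 (f_smooth x) t0. Qed.

Lemma expectation_dual_fin t x : 0 <= t ->
  ('E_(Pr eta)[f x \o eta_ t])%E = (u t x)%:E.
Proof.
move=> t0; rewrite /u fineK// unlock; apply: integrable_fin_num => //.
exact: dual_integrable.
Qed.

Let u_ge0 t x : 0 <= u t x.
Proof. by apply: fine_ge0; apply: expectation_ge0 => w /=. Qed.

Let expectation_gen t x : 0 <= t ->
  ('E_(Pr eta)[gen_BMP p (f x) \o eta_ t])%E = (g t x)%:E.
Proof.
move=> t0; rewrite unlock.
have H (l : seq (R * E)) :
    (Pr eta).-integrable [set: Omega]
      (fun w => (\sum_(r <- l) r.1 * f r.2 (eta_ t w))%:E) /\
    (\int[Pr eta]_w (\sum_(r <- l) r.1 * f r.2 (eta_ t w))%:E =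
      (\sum_(r <- l) r.1 * u t r.2)%:E)%E.
  elim: l => [|r l [IH1 IH2]].
    split; first by under eq_fun do rewrite big_nil; exact: integrable0.
    under eq_integral do rewrite big_nil.
    by rewrite big_nil integral0.
  have I1 : (Pr eta).-integrable [set: Omega] (fun w => (r.1 * f r.2 (eta_ t w))%:E).
    under eq_fun do rewrite EFinM.
    by apply: integrableZl => //; exact: dual_integrable.
  split.
    under eq_fun do rewrite big_cons EFinD.
    exact: integrableD.
  under eq_integral do rewrite big_cons EFinD.
  rewrite integralD// IH2 big_cons EFinD; congr (_ + _)%E.
  under eq_integral do rewrite EFinM.
  rewrite integralZl//; last exact: dual_integrable.
  by rewrite EFinM -expectation_dual_fin// unlock.
have [H1 H2] := H (G x).
under eq_integral do rewrite /= f_dual EFinB.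
rewrite integralB//; last first.
  under eq_fun do rewrite EFinM.
  by apply: integrableZl => //; exact: dual_integrable.
rewrite H2 /g EFinB; congr (_ - _)%E.
under eq_integral do rewrite EFinM.
rewrite integralZl//; last exact: dual_integrable.
by rewrite EFinM -expectation_dual_fin// unlock.
Qed.

Let g_integrable t x : 0 <= t -> mu.-integrable `[0, t] (EFin \o g^~ x).
Proof.
move=> t0; have [_] := BMP_integrable bmp eta_X0 (f_smooth x) t0.
apply: eq_integrable => // s; rewrite inE/= in_itv/= => /andP[s0 _].
by rewrite expectation_gen.
Qed.

Let u_integral t x : 0 <= t ->
  u t x = f x eta + \int[mu]_(s in `[0, t]) g s x.
Proof.
move=> t0; apply: EFin_inj; rewrite -expectation_dual_fin//.
rewrite (BMP_generator bmp eta_X0 (f_smooth x) t0) EFinD; congr (_ + _)%E.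
rewrite /Rintegral fineK; last first.
  by apply: integrable_fin_num => //; exact: g_integrable.
apply: eq_integral => s; rewrite inE/= in_itv/= => /andP[s0 _].
by rewrite expectation_gen.
Qed.

Let u0 x : u 0 x = f x eta.
Proof. by rewrite u_integral// set_itv1 Rintegral_set1 addr0. Qed.

Let u_continuous T x : 0 <= T -> {within `[0, T], continuous (u ^~ x)}.
Proof.
move=> T0.
have cF : {within `[0, T],
    continuous (fun t => f x eta + \int[mu]_(s in `[0, t]) g s x)}.
  move=> t; apply: cvgD; first exact: cvg_cst.
  move: t; apply: parameterized_integral_continuous => //.
  exact: g_integrable.
apply: subspace_eq_continuous cF => t.
by rewrite inE/= in_itv/= => /andP[t0 _]; exact/esym/u_integral.
Qed.

Let u_continuous_at (t : R) x : 0 < t -> {for t, continuous (u ^~ x)}.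
Proof.
move=> t0; have t10 : 0 < t + 1 by rewrite addr_gt0.
have [|+ _ _] := (continuous_within_itvP (u ^~ x) t10).1.
  exact: u_continuous (ltW t10).
move=> /(_ t); apply.
rewrite in_itv/= t0 /= ltrDl; exact: ltr01.
Qed.

Let g_continuous_at (t : R) x : 0 < t -> {for t, continuous (g ^~ x)}.
Proof.
move=> t0; apply: cvgB; last by apply: cvgMl_tmp; exact: u_continuous_at.
rewrite /jump; elim: (G x) => [|r l IH].
  by under eq_fun do rewrite big_nil; rewrite big_nil; exact: cvg_cst.
under eq_fun do rewrite big_cons.
rewrite big_cons; apply: cvgD => //.
by apply: cvgMl_tmp; exact: u_continuous_at.
Qed.

(** A bootstrap: integrability of [g] in time makes [u] continuous; [g] is a finite combination of
    values of [u], hence continuous at positive times; the fundamental theorem of calculus then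
    differentiates the integral identity. *)
Let is_derive_u (t : R) x : 0 < t -> is_derive t (1 : R) (u ^~ x) (g t x).
Proof.
move=> t0; have tt1 : t < t + 1 by rewrite ltrDl.
have t10 : 0 <= t + 1 by rewrite addr_ge0// ltW.
have [dF F'] := continuous_FTC1_closed tt1 (g_integrable x t10) t0
  (@g_continuous_at t x t0).
apply: (@near_eq_is_derive _ _ _
    (cst (f x eta) + (fun t => \int[mu]_(s in `[0, t]) g s x))).
  near=> s; rewrite /= u_integral//.
  by near: s; apply: filterS (lt_nbhsr t0) => s /ltW.
rewrite -[X in is_derive _ _ _ X]add0r; apply: is_deriveD.
by rewrite -F' derive1E; apply: derivableP.
Unshelve. all: by end_near. Qed.

Lemma is_derive_expRM (t : R) :
  is_derive t (1 : R) (fun s => expR (c * s)) (c * expR (c * t)).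
Proof.
have H : is_derive t (1 : R) (fun s : R => c * s) c.
  rewrite -[X in is_derive _ _ _ X]mulr1.
  exact: (@is_deriveZ _ _ _ id c).
have := @is_derive1_comp _ expR (fun s => c * s) t _ _ (is_derive_expR _) H.
by rewrite mulrC.
Qed.

(** Integrating factor: it absorbs the loss term, so [v] solves v' = G v with [G] positive. *)
Let v t x := expR (c * t) * u t x.

Let v_flow T : flow T v (fun t => jump G (v t)).
Proof.
move=> x; split.
  have [T0|T0] := leP 0 T; last first.
    rewrite set_itv_ge ?bnd_simp -?ltNge//; exact: continuous_subspace0.
  move=> t; apply: cvgM; last exact: u_continuous.
  move: t; apply: continuous_subspaceT => t.
  exact: is_derive_continuous (is_derive_expRM t).
move=> t /andP[t0 _].
apply: is_derive_eq (is_deriveM (is_derive_expRM t) (@is_derive_u t x t0)) _.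
rewrite /g /v jumpZ /GRing.scale/=; ring.
Qed.

(** This one-sided bound is all that is needed for n particles; the convergence in
    [duality_taylor_cvg] serves the one-particle side. *)
Lemma duality_taylor_lower N t x : 0 <= t ->
  (forall z, all (fun r : R * E => 0 <= r.1) (G z)) ->
  expR (- (c * t)) * taylor G N t (f ^~ eta) x <= u t x.
Proof.
move=> t0 G0; rewrite expRN ler_pdivrMl ?expR_gt0//.
rewrite (_ : f ^~ eta = v 0); last first.
  by apply/funext => z; rewrite /v mulr0 expR0 mul1r u0.
apply: (taylor_lower G0 (v_flow t)) => //; last by rewrite lexx t0.
by move=> s z _; rewrite /v mulr_ge0 ?expR_ge0 ?u_ge0.
Qed.

Lemma duality_taylor_cvg t x : 0 <= t ->
  (forall z, all (fun r : R * E => 0 <= r.1) (G z)) ->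
  expR (- (c * t)) * taylor G N t (f ^~ eta) x @[N --> \oo] --> u t x.
Proof.
move=> t0 G0.
have -> : u t x = expR (- (c * t)) * v t x.
  by rewrite /v mulrA -expRD addNr expR0 mul1r.
rewrite (_ : f ^~ eta = v 0); last first.
  by apply/funext => z; rewrite /v mulr0 expR0 mul1r u0.
apply: cvgMl_tmp; apply: nonneg_flow_series => // s z _.
by rewrite /v mulr_ge0 ?expR_ge0 ?u_ge0.
Qed.

End DualityFlow.

(** * The generator on monomials *)

Section Monomials.
Context {R : realType} {S : countType}.
Implicit Types (A : seq S) (a : R) (e : S -> nat) (x y : S) (eta : conf R S).

Definition monomial A a e eta : R := a * \prod_(z <- A) eta z ^+ e z.

Definition inc x e : S -> nat := fun z => (e z + (z == x))%N.
(** Truncation of the subtraction is harmless: derivatives and jumps pair [dec x e] with a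
    coefficient that vanishes when [e x = 0]. *)
Definition dec x e : S -> nat := fun z => (e z - (z == x))%N.

Lemma monomialE A a e eta x : uniq A -> x \in A ->
  monomial A a e eta = a * (\prod_(z <- A | z != x) eta z ^+ e z) * eta x ^+ e x.
Proof.
by move=> uA xA; rewrite /monomial (bigD1_seq x)//= mulrA -mulrA [X in a * X]mulrC mulrA.
Qed.

Lemma slice_monomial A a e eta x : uniq A -> x \in A ->
  slice x (monomial A a e) eta =
  (a * \prod_(z <- A | z != x) eta z ^+ e z) *: (@id R ^+ e x).
Proof.
move=> uA xA; apply/funext => s.
rewrite /slice (monomialE _ _ _ uA xA) {2}/upd eqxx.
rewrite (_ : \prod_(z <- A | _) _ = \prod_(z <- A | z != x) eta z ^+ e z).
  by rewrite /GRing.scale/= exprfctE.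
by apply: eq_bigr => z zx; rewrite /upd (negbTE zx).
Qed.

Lemma slice_monomial_notin A a e eta x : x \notin A ->
  slice x (monomial A a e) eta = cst (monomial A a e eta).
Proof.
move=> xA; apply/funext => s; rewrite /slice /monomial/=; congr (_ * _).
rewrite big_seq [RHS]big_seq; apply: eq_bigr => z zA; rewrite /upd.
by case: eqP => // zx; rewrite -zx zA in xA.
Qed.

Lemma is_derive_monomial A a e eta x : uniq A -> x \in A ->
  is_derive (eta x) (1 : R) (slice x (monomial A a e) eta)
    (monomial A (a * (e x)%:R) (dec x e) eta).
Proof.
move=> uA xA; rewrite slice_monomial//.
apply: is_derive_eq.
rewrite (monomialE _ _ _ uA xA) /dec eqxx subn1 /GRing.scale/= mulr1.
under [in RHS]eq_bigr => z zx do rewrite (negbTE zx) subn0.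
by ring.
Qed.

Lemma partial_monomial A a e x : uniq A -> x \in A ->
  partial x (monomial A a e) = monomial A (a * (e x)%:R) (dec x e).
Proof.
move=> uA xA; apply/funext => eta; rewrite /partial derive1E.
by have [_ ->] := is_derive_monomial a e eta uA xA.
Qed.

Lemma partial_monomial_notin A a e x : x \notin A ->
  partial x (monomial A a e) = monomial A 0 e.
Proof.
move=> xA; apply/funext => eta; rewrite /partial slice_monomial_notin//.
by rewrite derive1_cst /monomial mul0r.
Qed.

Lemma mul_monomial A a e x eta : uniq A -> x \in A ->
  eta x * monomial A a e eta = monomial A a (inc x e) eta.
Proof.
move=> uA xA; rewrite !(monomialE _ _ _ uA xA) /inc eqxx addn1 exprS.
under [in RHS]eq_bigr => z zx do rewrite (negbTE zx) addn0.
by ring.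
Qed.

Lemma derivable_monomial A a e x eta : uniq A ->
  derivable (slice x (monomial A a e) eta) (eta x) 1.
Proof.
move=> uA; have [xA|xA] := boolP (x \in A).
  by have [] := is_derive_monomial a e eta uA xA.
by rewrite slice_monomial_notin//; exact: derivable_cst.
Qed.

Lemma iter_partial_monomial A a e (s : seq S) : uniq A ->
  exists b g, iter_partial s (monomial A a e) = monomial A b g.
Proof.
move=> uA; elim: s => [|x s [b [g IH]]]; first by exists a, e.
rewrite /= IH; have [xA|xA] := boolP (x \in A).
  by rewrite partial_monomial//; eexists; eexists; reflexivity.
by rewrite partial_monomial_notin//; eexists; eexists; reflexivity.
Qed.

Lemma monomial_bound A a e eta :
  `|monomial A a e eta| <=
  `|a| * (1 + \sum_(z <- A) `|eta z|) ^+ (\sum_(z <- A) e z)%N.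
Proof.
rewrite /monomial normrM ler_wpM2l// normr_prod.
suff H (B : seq S) (K : R) : 1 <= K -> (forall z, z \in B -> `|eta z| <= K) ->
    \prod_(z <- B) `|eta z ^+ e z| <= K ^+ (\sum_(z <- B) e z)%N.
  apply: H => [|z zA]; first by rewrite lerDl sumr_ge0.
  rewrite (big_rem z)//= addrCA lerDl addr_ge0// sumr_ge0//.
move=> K1; elim: B => [|z B IH] HB; first by rewrite !big_nil.
rewrite !big_cons exprD ler_pM ?prodr_ge0//.
  rewrite normrX; apply: lerXn2r; rewrite ?nnegrE ?(le_trans ler01 K1)//.
  by apply: HB; rewrite mem_head.
by apply: IH => w wB; apply: HB; rewrite in_cons wB orbT.
Qed.

Lemma smooth_local_monomial A a e : uniq A -> smooth_local (monomial A a e).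
Proof.
move=> uA; exists A; split.
  move=> eta zeta H; rewrite /monomial; congr (_ * _).
  by rewrite big_seq [RHS]big_seq; apply: eq_bigr => z /H ->.
move=> s; have [b [g ->]] := iter_partial_monomial a e s uA; split.
  by move=> x eta; exact: derivable_monomial.
by exists `|b|, (\sum_(z <- A) g z)%N => eta; exact: monomial_bound.
Qed.

Lemma rot_monomial A a e x y : uniq A -> x \in A -> y \in A ->
  Defs.rot x y (monomial A a e) = (fun eta =>
    monomial A (a * (e y)%:R) (inc x (dec y e)) eta -
    monomial A (a * (e x)%:R) (inc y (dec x e)) eta).
Proof.
move=> uA xA yA; apply/funext => eta.
by rewrite /Defs.rot !partial_monomial// !mul_monomial.
Qed.

Lemma rotB x y (f g : conf R S -> R) :
  (forall z eta, derivable (slice z f eta) (eta z) 1) ->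
  (forall z eta, derivable (slice z g eta) (eta z) 1) ->
  Defs.rot x y (fun eta => f eta - g eta) =
  (fun eta => Defs.rot x y f eta - Defs.rot x y g eta).
Proof.
move=> df dg; apply/funext => eta; rewrite /Defs.rot /partial !derive1E.
have H z : 'D_1 (slice z (fun eta => f eta - g eta) eta) (eta z) =
    'D_1 (slice z f eta) (eta z) - 'D_1 (slice z g eta) (eta z).
  by rewrite -deriveB.
by rewrite !H; ring.
Qed.

(** Each rotation shifts one unit of exponent between [x] and [y]. Two shifts in the same direction
    give the first two terms; a shift followed by its inverse gives the diagonal term, negative by
    antisymmetry of the rotation. *)
Lemma rot2_monomial A a e x y eta : uniq A -> x \in A -> y \in A -> x != y ->
  Defs.rot x y (Defs.rot x y (monomial A a e)) eta =
  monomial A (a * (e y * (e y).-1)%:R) (inc x (inc x (dec y (dec y e)))) eta +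
  monomial A (a * (e x * (e x).-1)%:R) (inc y (inc y (dec x (dec x e)))) eta -
  (e y * (e x).+1 + e x * (e y).+1)%:R * monomial A a e eta.
Proof.
move=> uA xA yA xy; have yx : y != x by rewrite eq_sym.
rewrite rot_monomial// rotB; [|by move=> *; exact: derivable_monomial..].
rewrite !rot_monomial//.
(* A shift and its inverse restore [e] unless [e u = 0], where [dec] truncates; in that case the
   coefficient is 0. *)
have key u v c (w : R) : u != v ->
    monomial A (w * (e u)%:R * c) (inc u (dec v (inc v (dec u e)))) eta =
    (e u)%:R * c * monomial A w e eta.
  move=> uv; have [->|e0] := posnP (e u).
    by rewrite /monomial mulr0 !mul0r.
  rewrite /monomial (_ : inc _ _ = e); first by ring.
  apply/funext => z; rewrite /inc /dec.
  have [->|zu] := eqVneq z u; first by rewrite (negbTE uv); lia.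
  by case: eqP => _; lia.
rewrite !key//.
have c1 u v : u != v -> inc u (dec v e) v = (e v).-1.
  by move=> uv; rewrite /inc /dec eqxx eq_sym (negbTE uv); lia.
have c2 u v : u != v -> inc u (dec v e) u = (e u).+1.
  by move=> uv; rewrite /inc /dec eqxx (negbTE uv); lia.
rewrite !c1// !c2//.
have ie u v : u != v -> inc u (dec v (inc u (dec v e))) = inc u (inc u (dec v (dec v e))).
  move=> uv; apply/funext => z; rewrite /inc /dec.
  have [->|zu] := eqVneq z u; first by rewrite (negbTE uv); lia.
  by case: eqP => _; lia.
rewrite !ie// !natrM natrD !natrM /monomial; ring.
Qed.

End Monomials.

(** * The generator on duality polynomials *)

Section Generator.
Context {R : realType} {S : countType}.
Implicit Types (A : seq S) (xi : S -> nat) (x y : S) (eta : conf R S).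

Lemma odd_dfact_gt0 k : (0 < odd_dfact k)%N.
Proof. by rewrite /odd_dfact prodn_gt0// => i; rewrite addn1. Qed.

Lemma odd_dfactS k : odd_dfact k.+1 = (odd_dfact k * (2 * k + 1))%N.
Proof. by rewrite /odd_dfact big_ord_recr. Qed.

Lemma bigD2_seq A x y (F : S -> R) : uniq A -> x \in A -> y \in A -> x != y ->
  \prod_(z <- A) F z =
  F x * (F y * \prod_(z <- A | (z != x) && (z != y)) F z).
Proof.
move=> uA xA yA xy; rewrite (bigD1_seq x)//= -big_filter.
rewrite (bigD1_seq y) ?filter_uniq ?mem_filter ?yA 1?eq_sym ?xy//=.
by rewrite big_filter_cond.
Qed.

Definition dcoef A xi : R := \prod_(z <- A) (odd_dfact (xi z))%:R^-1.

Lemma D_prod A xi eta : uniq A -> (forall z, z \notin A -> xi z = 0%N) ->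
  D xi eta = \prod_(z <- A) (eta z ^+ (2 * xi z) / (odd_dfact (xi z))%:R).
Proof.
move=> uA H; rewrite /D (fsbigE A)//.
  by rewrite big_mkcond/=; apply: eq_bigr => i _; rewrite in_setT.
move=> z _ zA; rewrite H// muln0 expr0 /odd_dfact big_ord0 divr1//.
Qed.

Lemma D_monomial A xi : uniq A -> (forall z, z \notin A -> xi z = 0%N) ->
  D xi = monomial A (dcoef A xi) (fun z => 2 * xi z)%N :> (conf R S -> R).
Proof.
move=> uA H; apply/funext => eta; rewrite (D_prod _ uA H) /monomial /dcoef.
by rewrite big_split/= mulrC.
Qed.

Lemma D_ge0 A xi eta : (forall z, z \notin A -> xi z = 0%N) -> 0 <= D xi eta.
Proof.
move=> H; rewrite (D_prod (A := undup A)) ?undup_uniq//; last first.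
  by move=> z; rewrite mem_undup; exact: H.
by apply: prodr_ge0 => z _; rewrite divr_ge0// exprM exprn_ge0// sqr_ge0.
Qed.

Lemma smooth_local_D A xi : (forall z, z \notin A -> xi z = 0%N) ->
  smooth_local (D xi : conf R S -> R).
Proof.
move=> H; rewrite (D_monomial (A := undup A)) ?undup_uniq//; last first.
  by move=> z; rewrite mem_undup; exact: H.
by apply: smooth_local_monomial; exact: undup_uniq.
Qed.

(** One direction of the dual inclusion process: the rate grows with the occupation of the target,
    which is the attraction between particles. *)
Definition jump_term xi x y eta : R :=
  (2 * xi x * (2 * xi y + 1))%:R * (D (inc y (dec x xi)) eta - D xi eta).

(** The double factorials normalise the rates: removing a particle at [x] cancels the factor 2
    [xi x] - 1 produced by the second derivative, and adding one at [y] supplies 2 [xi y] + 1. *)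
Lemma monomial_jump A xi x y eta : uniq A ->
  (forall z, z \notin A -> xi z = 0%N) -> x \in A -> y \in A -> x != y ->
  monomial A (dcoef A xi * (2 * xi x * (2 * xi x).-1)%:R)
    (inc y (inc y (dec x (dec x (fun z => 2 * xi z)%N)))) eta =
  (2 * xi x * (2 * xi y + 1))%:R * D (inc y (dec x xi)) eta.
Proof.
move=> uA H xA yA xy; have [x0|x0] := posnP (xi x).
  by rewrite x0 /monomial !muln0 !mul0n mulr0 !mul0r.
have yx : y != x by rewrite eq_sym.
have H' z : z \notin A -> inc y (dec x xi) z = 0%N.
  move=> zA; rewrite /inc /dec H// sub0n add0n.
  by case: eqP => // zy; rewrite -zy (negbTE zA) in yA.
rewrite (D_monomial uA H') /monomial mulrA; congr (_ * _); last first.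
  apply: eq_bigr => z _; congr (_ ^+ _); rewrite /inc /dec.
  have [->|zx] := eqVneq z x; first by rewrite (negbTE xy); lia.
  by case: eqP => _; lia.
rewrite /dcoef !(bigD2_seq _ uA xA yA xy).
rewrite [X in _ = _ * (_ * (_ * X))](_ : _ =
    \prod_(z <- A | (z != x) && (z != y)) (odd_dfact (xi z))%:R^-1); last first.
  apply: eq_bigr => z /andP[/negbTE zx /negbTE zy].
  by rewrite /inc /dec zx zy subn0 addn0.
have -> : inc y (dec x xi) x = (xi x).-1.
  by rewrite /inc /dec eqxx (negbTE xy) addn0 subn1.
have -> : inc y (dec x xi) y = (xi y).+1.
  by rewrite /inc /dec eqxx (negbTE yx) subn0 addn1.
rewrite -[in LHS](prednK x0) !odd_dfactS.
move: (odd_dfact_gt0 (xi x).-1) (odd_dfact_gt0 (xi y)).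
move: (odd_dfact _) (odd_dfact _) => a b a0 b0.
have -> : (2 * (xi x).-1.+1 * (2 * (xi x).-1.+1).-1 =
  2 * (xi x).-1.+1 * (2 * (xi x).-1 + 1))%N by lia.
rewrite -[in RHS](prednK x0); move: (xi x).-1 (xi y) => k l.
rewrite !natrM; field.
by rewrite !pnatr_eq0 -!lt0n a0 b0 /= -!natrM !natr1 !pnatr_eq0.
Qed.

(** The diagonal coefficient in [rot2_monomial] is exactly the sum of the two jump rates. A
    differential operator in [eta] thus becomes a conservative jump operator in [xi], which is the
    duality. *)
Lemma rot2_D A xi x y eta : (forall z, z \notin A -> xi z = 0%N) -> x != y ->
  Defs.rot x y (Defs.rot x y (D xi)) eta =
  jump_term xi x y eta + jump_term xi y x eta.
Proof.
move=> H0 xy; pose B := undup [:: x, y & A].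
have uB : uniq B by exact: undup_uniq.
have H z : z \notin B -> xi z = 0%N.
  by rewrite mem_undup !inE !negb_or => /and3P[_ _]; exact: H0.
have xB : x \in B by rewrite mem_undup !inE eqxx.
have yB : y \in B by rewrite mem_undup !inE eqxx orbT.
have yx : y != x by rewrite eq_sym.
rewrite {1}(D_monomial uB H) rot2_monomial// !monomial_jump// -D_monomial//.
rewrite /jump_term !natrD !natrM; ring.
Qed.

(** [A] carries the particles and [B] also their neighbours. For a pair outside [B] x [B], either
    [p] vanishes or both sites are empty and both jump terms vanish. Symmetry of [p] merges the two
    directions, whence the factor 2. *)
Lemma gen_D A B xi (p : S -> S -> R) eta :
  (forall x y, p x y = p y x) -> (forall x, p x x = 0) ->
  uniq B -> {subset A <= B} ->
  (forall x y, x \in A -> y \notin B -> p x y = 0) ->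
  (forall z, z \notin A -> xi z = 0%N) ->
  gen_BMP p (D xi) eta =
  \sum_(x <- B) \sum_(y <- B) 2 * p x y * jump_term xi x y eta.
Proof.
move=> ps pd uB AB pB H.
have T0 x y : x \notin A -> jump_term xi x y eta = 0.
  by move=> xA; rewrite /jump_term H// muln0 mul0n mul0r.
rewrite /gen_BMP.
have gE x y : p x y * Defs.rot x y (Defs.rot x y (D xi)) eta =
    p x y * (jump_term xi x y eta + jump_term xi y x eta).
  have [->|xy] := eqVneq x y; first by rewrite pd !mul0r.
  by rewrite (rot2_D _ H).
rewrite (fsbigE (allpairs pair B B))//.
- rewrite big_mkcond/=.
  under eq_bigr do rewrite in_setT gE.
  rewrite big_allpairs_dep/=.
  under eq_bigr => x _ do under eq_bigr => y _ do rewrite mulrDr.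
  under eq_bigr => x _ do rewrite big_split/=.
  rewrite big_split/= [X in _ + X]exchange_big/= -big_split/=.
  apply: eq_bigr => x _; rewrite -big_split/=; apply: eq_bigr => y _.
  by rewrite (ps y x); ring.
- by apply: allpairs_uniq => // -[a b] [c d] _ _ [-> ->].
- move=> [x y] _ /= xyB; rewrite gE.
  have [xA|xA] := boolP (x \in A); have [yA|yA] := boolP (y \in A).
  + by move: xyB; rewrite allpairs_f// AB.
  + rewrite pB ?mul0r//; apply: contra xyB => yB; rewrite allpairs_f// AB//.
  + rewrite ps pB ?mul0r//; apply: contra xyB => xB; rewrite allpairs_f// AB//.
  + by rewrite !T0// addr0 mulr0.
Qed.

End Generator.

(** * Labelled particles and the symmetric inclusion process *)

Section LabelledParticles.
Context {R : realType} {S : countType}.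
Variables (p : S -> S -> R) (nb : S -> seq S).
Hypothesis p_sym : forall x y, p x y = p y x.
Hypothesis p_ge0 : forall x y, 0 <= p x y.
Hypothesis p_diag : forall x, p x x = 0.
Hypothesis nb_uniq : forall x, uniq (nb x).
Hypothesis nb_supp : forall x y, y \notin nb x -> p x y = 0.
Hypothesis nb_sum : forall x, \sum_(y <- nb x) p x y = 1.

(** [D] sees only occupation numbers, but labels are needed for the comparison with independent
    walks, which involves functions of n positions. *)
Definition move_particle n (x : 'I_n -> S) (i : 'I_n) (v : S) : 'I_n -> S :=
  fun k => if k == i then v else x k.

Lemma particles_move n (x : 'I_n -> S) i v :
  particles (move_particle x i v) = inc v (dec (x i) (particles x)).
Proof.
apply/funext => z; rewrite /inc /dec /particles (bigD1 i)//= [in RHS](bigD1 i)//=.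
rewrite /delta /move_particle eqxx.
rewrite (eq_bigr (fun k => (x k == z) : nat)); last first.
  by move=> k /negbTE ->.
by rewrite (eq_sym z v) (eq_sym z (x i)); lia.
Qed.

Lemma particles_notin n (x : 'I_n -> S) z : z \notin codom x ->
  particles x z = 0%N.
Proof.
move=> zx; rewrite /particles big1// => i _; rewrite /delta.
by case: eqP => // xz; rewrite -xz codom_f in zx.
Qed.

Lemma sum_particles n (x : 'I_n -> S) (B : seq S) (F : S -> R) : uniq B ->
  (forall i, x i \in B) ->
  \sum_(u <- B) (particles x u)%:R * F u = \sum_i F (x i).
Proof.
move=> uB xB.
under eq_bigr => u _ do rewrite /particles natr_sum mulr_suml.
rewrite exchange_big/=; apply: eq_bigr => i _.
rewrite (bigD1_seq (x i))//= /delta eqxx mul1r big1 ?addr0// => u ux.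
by rewrite eq_sym (negbTE ux) mul0r.
Qed.

Lemma sum_neighbours (B : seq S) x (F : S -> R) : uniq B ->
  {subset nb x <= B} ->
  \sum_(v <- B) p x v * F v = \sum_(v <- nb x) p x v * F v.
Proof.
move=> uB nbB; rewrite (bigID (mem (nb x)))/= [X in _ + X]big1 ?addr0.
  rewrite -big_filter; apply: perm_big; apply: uniq_perm => //.
    exact: filter_uniq.
  by move=> z; rewrite mem_filter; case: (boolP (z \in nb x)) => // /nbB ->.
by move=> v /nb_supp ->; rewrite mul0r.
Qed.

Lemma gen_particles n (x : 'I_n -> S) eta :
  gen_BMP p (D (particles x)) eta =
  \sum_i \sum_(v <- nb (x i)) 4 * p (x i) v *
    (D (particles (move_particle x i v)) eta - D (particles x) eta) +
  \sum_i \sum_j 8 * p (x i) (x j) *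
    (D (particles (move_particle x i (x j))) eta - D (particles x) eta).
Proof.
pose B := undup (codom x ++ flatten [seq nb u | u <- codom x]).
have uB : uniq B by exact: undup_uniq.
have xB i : x i \in B by rewrite mem_undup mem_cat codom_f.
have nbB i : {subset nb (x i) <= B}.
  move=> v vx; rewrite mem_undup mem_cat; apply/orP; right.
  by apply/flatten_mapP; exists (x i) => //; exact: codom_f.
rewrite (@gen_D _ _ (codom x) B)//; last 3 first.
- by move=> v /codomP[i ->].
- by move=> u v /codomP[i ->] vB; apply: nb_supp; apply: contra vB => /nbB.
- by move=> z; exact: particles_notin.
pose F u v : R := D (inc v (dec u (particles x))) eta - D (particles x) eta.
(* Each particle at [u] jumps at rate 4 p (2 [particles x v] + 1): the part 4 p is the walk, and 8 p
   times the occupation of [v] becomes a sum over the labels of the particles there. The label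
   [j = i] contributes nothing since [p] vanishes on the diagonal. *)
transitivity (\sum_(u <- B) (particles x u)%:R *
    (\sum_(v <- B) 4 * p u v * (2 * particles x v + 1)%:R * F u v)).
  apply: eq_bigr => u _; rewrite mulr_sumr; apply: eq_bigr => v _.
  by rewrite /jump_term -/(F u v) !natrM; ring.
rewrite sum_particles// -big_split/=; apply: eq_bigr => i _.
transitivity (\sum_(v <- B) p (x i) v * (4 * F (x i) v) +
   \sum_(v <- B) (particles x v)%:R * (8 * p (x i) v * F (x i) v)).
  rewrite -big_split; apply: eq_bigr => v _ /=.
  by rewrite natrD natrM; ring.
rewrite sum_particles// sum_neighbours//; congr (_ + _).
  by apply: eq_bigr => v _; rewrite /F particles_move; ring.
by apply: eq_bigr => j _; rewrite /F particles_move.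
Qed.

Definition inclusion_rate n (x : 'I_n -> S) : R :=
  \sum_i \sum_j 8 * p (x i) (x j).

(** Rate 4 per walk plus 8 per ordered pair of labels. As [p] is at most 1, the second part
    dominates [inclusion_rate], which keeps the null jump of [sip_jumps] nonnegative. *)
Definition sip_rate n : R := 4 * n%:R + 8 * n%:R * n%:R.

(* The last entry is a null jump that makes the total rate independent of [x]. *)
Definition sip_jumps n (x : 'I_n -> S) : seq (R * ('I_n -> S)) :=
  [seq (4 * p (x i) v, move_particle x i v) | i <- enum 'I_n, v <- nb (x i)] ++
  [seq (8 * p (x i) (x j), move_particle x i (x j)) | i <- enum 'I_n, j <- enum 'I_n] ++
  [:: (8 * n%:R * n%:R - inclusion_rate x, x)].

Definition walk_jumps (x : S) : seq (R * S) := [seq (4 * p x v, v) | v <- nb x].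

Lemma jump_sip n (w : ('I_n -> S) -> R) x :
  jump (@sip_jumps n) w x =
  \sum_i \sum_(v <- nb (x i)) 4 * p (x i) v * w (move_particle x i v) +
  \sum_i \sum_j 8 * p (x i) (x j) * w (move_particle x i (x j)) +
  (8 * n%:R * n%:R - inclusion_rate x) * w x.
Proof.
rewrite /jump /sip_jumps !big_cat big_seq1 /= addrA !big_allpairs_dep/=.
rewrite !big_enum/=; congr (_ + _ + _).
by apply: eq_bigr => i _; rewrite big_enum.
Qed.

Lemma jump_walk h x :
  jump walk_jumps h x = \sum_(v <- nb x) 4 * p x v * h v.
Proof. by rewrite /jump /walk_jumps big_map. Qed.

Lemma walk_prob_le1 x y : p x y <= 1.
Proof.
have [xy|/nb_supp ->//] := boolP (y \in nb x).
by rewrite -(nb_sum x) (big_rem y)//= lerDl sumr_ge0.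
Qed.

Lemma inclusion_rate_le n (x : 'I_n -> S) :
  inclusion_rate x <= 8 * n%:R * n%:R.
Proof.
have -> : 8 * n%:R * n%:R = \sum_(i < n) \sum_(j < n) (8 : R).
  by rewrite !sumr_const !card_ord -[RHS]mulr_natr -[8 *+ n]mulr_natr.
by apply: ler_sum => i _; apply: ler_sum => j _; rewrite ler_piMr// walk_prob_le1.
Qed.

Lemma sip_jumps_ge0 n (x : 'I_n -> S) :
  all (fun r : R * ('I_n -> S) => 0 <= r.1) (sip_jumps x).
Proof.
rewrite /sip_jumps !all_cat /= andbT subr_ge0 inclusion_rate_le andbT.
by apply/andP; split; apply/all_allpairsP => i v _ _ /=; rewrite mulr_ge0.
Qed.

Lemma walk_jumps_ge0 x : all (fun r : R * S => 0 <= r.1) (walk_jumps x).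
Proof. by rewrite all_map; apply/allP => v _ /=; rewrite mulr_ge0. Qed.

Lemma sip_jumps_sum n (x : 'I_n -> S) :
  \sum_(r <- sip_jumps x) r.1 = sip_rate n.
Proof.
have := jump_sip (fun=> 1) x; rewrite /jump.
under eq_bigr do rewrite mulr1; move=> ->.
under eq_bigr do under eq_bigr do rewrite mulr1.
under eq_bigr do rewrite -mulr_sumr nb_sum mulr1.
under [X in _ + X + _]eq_bigr do under eq_bigr do rewrite mulr1.
rewrite sumr_const card_ord mulr1 -/(inclusion_rate x) /sip_rate -[4 *+ n]mulr_natr.
ring.
Qed.

Lemma gen_sip n (x : 'I_n -> S) eta :
  gen_BMP p (D (particles x)) eta =
  jump (@sip_jumps n) (fun z => D (particles z) eta) x -
  sip_rate n * D (particles x) eta.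
Proof.
rewrite gen_particles jump_sip.
under eq_bigr do under eq_bigr do rewrite mulrBr.
under [X in _ + X = _]eq_bigr do under eq_bigr do rewrite mulrBr.
under eq_bigr do rewrite sumrB.
under [X in _ + X = _]eq_bigr do rewrite sumrB.
rewrite !sumrB.
under [X in _ - X + _ = _]eq_bigr do rewrite -mulr_suml -mulr_sumr nb_sum.
under [X in _ + (_ - X) = _]eq_bigr do rewrite -mulr_suml.
rewrite -!mulr_suml -/(inclusion_rate x).
rewrite sumr_const card_ord /sip_rate -[_ *+ n]mulr_natr; ring.
Qed.

Lemma delta_particles (x : S) : delta x = particles (fun _ : 'I_1 => x).
Proof. by apply/funext => y; rewrite /particles big_ord1. Qed.

(** A single particle feels no attraction because [p x x = 0], so the loss rate is 4; [sip_rate 1],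
    which includes the null jump, would be 12. *)
Lemma gen_walk x eta :
  gen_BMP p (D (delta x)) eta =
  jump walk_jumps (fun z => D (delta z) eta) x - 4 * D (delta x) eta.
Proof.
rewrite delta_particles gen_particles !big_ord1 p_diag mulr0 mul0r addr0.
rewrite jump_walk.
have H v : move_particle (fun _ : 'I_1 => x) ord0 v = fun=> v.
  by apply/funext => k; rewrite /move_particle ord1.
under eq_bigr do rewrite mulrBr H -delta_particles.
by rewrite sumrB -mulr_suml -mulr_sumr nb_sum mulr1.
Qed.

End LabelledParticles.

Lemma is_derive_prod {R : realType} (I : eqType) (s : seq I) (F dF : I -> R -> R)
    (t : R) : uniq s ->
  (forall i, is_derive t (1 : R) (F i) (dF i t)) ->
  is_derive t (1 : R) (fun r => \prod_(i <- s) F i r)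
    (\sum_(i <- s) dF i t * \prod_(j <- s | j != i) F j t).
Proof.
move=> us dFi; elim: s us => [_|i s IH /= /andP[is_ us]].
  under eq_fun do rewrite big_nil.
  rewrite big_nil; exact: is_derive_cst.
rewrite (_ : (fun r => _) = F i * (fun r => \prod_(i <- s) F i r)); last first.
  by apply/funext => r; rewrite big_cons.
apply: is_derive_eq (is_deriveM (dFi i) (IH us)) _.
rewrite big_cons big_cons eqxx/= /GRing.scale/= addrC; congr (_ + _).
  rewrite mulrC; congr (_ * _); rewrite big_seq [RHS]big_seq_cond.
  apply: eq_bigl => j; case: (boolP (j \in s)) => //= js.
  by apply/esym; apply: contraNneq is_ => <-.
rewrite mulr_sumr; apply: eq_big_seq => k ks.
rewrite big_cons (_ : i != k); first by ring.
by apply: contraNneq is_ => ->.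
Qed.

(** * Comparison of independent walks with the inclusion process *)

Section Comparison.
Context {R : realType} {S : countType}.
Variables (p : S -> S -> R) (nb : S -> seq S).
Hypothesis p_sym : forall x y, p x y = p y x.
Hypothesis p_ge0 : forall x y, 0 <= p x y.
Hypothesis nb_supp : forall x y, y \notin nb x -> p x y = 0.
Hypothesis nb_sum : forall x, \sum_(y <- nb x) p x y = 1.
Variable n : nat.
Local Notation walk := (walk_jumps p nb).
Local Notation sip := (@sip_jumps _ _ p nb n).

Definition prodf (h : S -> R) (x : 'I_n -> S) : R := \prod_i h (x i).

Lemma prodf_ge0 h x : (forall z, 0 <= h z) -> 0 <= prodf h x.
Proof. by move=> h0; exact: prodr_ge0. Qed.

Lemma prodf_le h g x : (forall z, 0 <= h z <= g z) -> prodf h x <= prodf g x.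
Proof. by move=> hg; apply: ler_prod. Qed.

Lemma prodf_move h x i v :
  prodf h (move_particle x i v) = h v * \prod_(j | j != i) h (x j).
Proof.
rewrite /prodf (bigD1 i)//= {1}/move_particle eqxx; congr (_ * _).
by apply: eq_bigr => j /negbTE ji; rewrite /move_particle ji.
Qed.

(* The attraction between particles favours product functions: for each pair
   [i], [j] the two moves contribute [(h (x j) - h (x i)) ^+ 2]. *)
Lemma inclusion_ge0 h x : (forall z, 0 <= h z) ->
  inclusion_rate p x * prodf h x <=
  \sum_i \sum_j 8 * p (x i) (x j) * prodf h (move_particle x i (x j)).
Proof.
move=> h0; rewrite /inclusion_rate mulr_suml -subr_ge0 -sumrB.
under eq_bigr do rewrite mulr_suml -sumrB.
set F := fun i j => 8 * p (x i) (x j) * prodf h (move_particle x i (x j)) -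
  8 * p (x i) (x j) * prodf h x.
(* Doubling the sum and exchanging the indices in one copy puts the two moves of each pair side by
   side. *)
suff : 0 <= \sum_i \sum_j F i j + \sum_i \sum_j F i j by lra.
rewrite [X in _ + X]exchange_big/= -big_split/=.
apply: sumr_ge0 => i _; rewrite -big_split/=; apply: sumr_ge0 => j _.
have [<-|ij] := eqVneq i j.
  rewrite /F (_ : move_particle x i (x i) = x) ?subrr ?addr0//.
  by apply/funext => k; rewrite /move_particle; case: eqP => // ->.
have ji : j != i by rewrite eq_sym.
have P2 z : prodf h z =
    h (z i) * (h (z j) * \prod_(k | (k != i) && (k != j)) h (z k)).
  by rewrite /prodf (bigD1 i)//= (bigD1 j).
have Pm k v : (k == i) || (k == j) ->
    \prod_(l | (l != i) && (l != j)) h (move_particle x k v l) =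
    \prod_(l | (l != i) && (l != j)) h (x l).
  move=> kij; apply: eq_bigr => l /andP[/negbTE li /negbTE lj].
  by rewrite /move_particle; case/orP: kij => /eqP ->; rewrite ?li ?lj.
rewrite /F (p_sym (x j)) !P2 !Pm ?eqxx ?orbT//.
rewrite /move_particle !eqxx (negbTE ij) (negbTE ji).
set r := \prod_(k | _) _.
have r0 : 0 <= r by apply: prodr_ge0.
rewrite [leRHS](_ : _ = 8 * p (x i) (x j) * r * (h (x j) - h (x i)) ^+ 2).
  by rewrite mulr_ge0 ?sqr_ge0// !mulr_ge0.
ring.
Qed.

Lemma walk_taylor_ge0 (rho : S -> R) m t z : (forall z, 0 <= rho z) -> 0 <= t ->
  0 <= taylor walk m t rho z.
Proof. by move=> r0 t0; apply: taylor_ge0 => // u; exact: walk_jumps_ge0. Qed.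

Lemma walk_taylor_le (rho : S -> R) m t z : (forall z, 0 <= rho z) -> 0 <= t ->
  taylor walk m t rho z <= taylor walk m.+1 t rho z.
Proof.
move=> r0 t0; rewrite taylorS lerDl mulr_ge0 ?divr_ge0 ?exprn_ge0//.
by apply: iter_jump_ge0 => // u; exact: walk_jumps_ge0.
Qed.

Lemma walk_taylor_bounded (rho : S -> R) (b : R) m T : (forall z, 0 <= rho z <= b) ->
  0 <= T -> exists c, forall t z, 0 <= t <= T -> taylor walk m t rho z <= c.
Proof.
move=> rb T0; exists (\sum_(k < m) T ^+ k / k`!%:R * (4 ^+ k * b)).
move=> t z /andP[t0 tT]; apply: ler_sum => k _.
apply: ler_pM; rewrite ?divr_ge0 ?exprn_ge0//.
- apply: iter_jump_ge0 => [u|u]; first exact: walk_jumps_ge0.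
  by have /andP[] := rb u.
- by rewrite ler_wpM2r// lerXn2r.
- rewrite -(@iter_jump_cst _ _ walk 4 _ k b z); last first.
    by move=> u; rewrite big_map/= -mulr_sumr nb_sum mulr1.
  apply: iter_jump_le => [u|u]; first exact: walk_jumps_ge0.
  by have /andP[] := rb u.
Qed.

(* [expR (8 n^2 t) * prodf (taylor walk m.+1 t rho)] is a bounded
   subsolution of the equation of the SIP: replacing the series of the walk by a
   Taylor polynomial only decreases its time derivative. *)
Lemma walk_le_sip_bounded (rho : S -> R) (b M T : R) m x :
  (forall z, 0 <= rho z <= b) -> 0 <= T ->
  (forall N, taylor sip N T (prodf rho) x <= M) ->
  expR (8 * n%:R * n%:R * T) * prodf (taylor walk m.+1 T rho) x <= M.
Proof.
move=> rb T0 HM; set kappa := 8 * n%:R * n%:R.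
have r0 z : 0 <= rho z by have /andP[] := rb z.
have k0 : 0 <= kappa by rewrite /kappa !mulr_ge0.
pose y t z := expR (kappa * t) * prodf (taylor walk m.+1 t rho) z.
pose dy t z := kappa * y t z + expR (kappa * t) *
  \sum_i jump walk (taylor walk m t rho) (z i) *
    \prod_(j | j != i) taylor walk m.+1 t rho (z j).
have dyP z (t : R) : is_derive t (1 : R) (y ^~ z) (dy t z).
  have H : is_derive t (1 : R) (fun r => prodf (taylor walk m.+1 r rho) z)
     (\sum_i jump walk (taylor walk m t rho) (z i) *
      \prod_(j | j != i) taylor walk m.+1 t rho (z j)).
    have := @is_derive_prod R 'I_n (index_enum 'I_n)
      (fun i r => taylor walk m.+1 r rho (z i))
      (fun i r => jump walk (taylor walk m r rho) (z i)) t (index_enum_uniq _).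
    by apply => i; exact: is_derive_taylor.
  apply: is_derive_eq (is_deriveM (is_derive_expRM kappa t) H) _.
  by rewrite /dy /y /GRing.scale/=; ring.
have y0 : y 0 = prodf rho.
  apply/funext => z; rewrite /y mulr0 expR0 mul1r.
  by apply: eq_bigr => i _; rewrite taylor_at0.
have [c Hc] := walk_taylor_bounded m.+1 rb T0.
rewrite -/(y T x).
apply: (bounded_subflow_le (sip_jumps_ge0 p_ge0 nb_supp nb_sum (n := n))
  (sip_jumps_sum nb_sum (n := n)) (b := expR (kappa * T) * c ^+ n) T0
  (y := y) (dy := dy)).
- move=> z; split; last by move=> t _; exact: dyP.
  apply: continuous_subspaceT => t; exact: is_derive_continuous (dyP z t).
- move=> t z /andP[t0 tT]; apply: ler_pM; rewrite ?expR_ge0//.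
  + by apply: prodf_ge0 => u; exact: walk_taylor_ge0.
  + by rewrite ler_expR ler_wpM2l.
  + rewrite (_ : c ^+ n = \prod_(i < n) c); last by rewrite prodr_const card_ord.
    by apply: ler_prod => i _; rewrite walk_taylor_ge0//= Hc// t0 tT.
- move=> t z /andP[/ltW t0 tT].
  set h := taylor walk m.+1 t rho.
  have h0 u : 0 <= h u by exact: walk_taylor_ge0.
  rewrite (_ : y t = fun z => expR (kappa * t) * prodf h z)//.
  rewrite jumpZ /dy {1}/y -/h mulrCA -mulrDr ler_wpM2l ?expR_ge0//.
  rewrite jump_sip.
  have up : \sum_i jump walk (taylor walk m t rho) (z i) *
      \prod_(j | j != i) h (z j) <=
      \sum_i \sum_(v <- nb (z i)) 4 * p (z i) v * prodf h (move_particle z i v).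
    apply: ler_sum => i _.
    have -> : \sum_(v <- nb (z i)) 4 * p (z i) v *
        prodf h (move_particle z i v) = jump walk h (z i) *
        \prod_(j | j != i) h (z j).
      rewrite jump_walk mulr_suml; apply: eq_bigr => v _.
      by rewrite prodf_move mulrA.
    rewrite ler_wpM2r ?prodr_ge0//; apply: jump_le => [u|u].
      exact: walk_jumps_ge0.
    exact: walk_taylor_le.
  (* The term in [kappa] is covered jointly: [inclusion_rate p z] times the product by the
     attraction, the rest of [kappa] by the null jump. *)
  have := inclusion_ge0 z h0; rewrite -/kappa; lra.
- by move=> N; rewrite y0.
Qed.

Lemma jump_cvg {E : Type} (G : E -> seq (R * E)) (v : nat -> E -> R)
    (w : E -> R) x : (forall z, v B z @[B --> \oo] --> w z) ->
  jump G (v B) x @[B --> \oo] --> jump G w x.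
Proof.
move=> vw; rewrite /jump; elim: (G x) => [|r l IHl].
  by under eq_fun do rewrite big_nil; rewrite big_nil; exact: cvg_cst.
under eq_fun do rewrite big_cons; rewrite big_cons; apply: cvgD => //.
exact: cvgMl_tmp.
Qed.

Lemma iter_jump_cvg {E : Type} (G : E -> seq (R * E)) (v : nat -> E -> R)
    (w : E -> R) k x : (forall z, v B z @[B --> \oo] --> w z) ->
  iter k (jump G) (v B) x @[B --> \oo] --> iter k (jump G) w x.
Proof.
by move=> vw; elim: k x => // k IH x; exact: jump_cvg.
Qed.

Lemma taylor_cvg {E : Type} (G : E -> seq (R * E)) (v : nat -> E -> R)
    (w : E -> R) N t x : (forall z, v B z @[B --> \oo] --> w z) ->
  taylor G N t (v B) x @[B --> \oo] --> taylor G N t w x.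
Proof.
move=> vw; elim: N => [|N IH].
  under eq_fun do rewrite /taylor big_ord0.
  by rewrite /taylor big_ord0; exact: cvg_cst.
under eq_fun do rewrite taylorS; rewrite taylorS; apply: cvgD => //.
by apply: cvgMl_tmp; exact: iter_jump_cvg.
Qed.

Lemma prodf_cvg (h : nat -> S -> R) (g : S -> R) x :
  (forall z, h B z @[B --> \oo] --> g z) ->
  prodf (h B) x @[B --> \oo] --> prodf g x.
Proof.
move=> hg; rewrite /prodf; elim: (index_enum _) => [|i l IH].
  by under eq_fun do rewrite big_nil; rewrite big_nil; exact: cvg_cst.
by under eq_fun do rewrite big_cons; rewrite big_cons; apply: cvgM.
Qed.

(** Cutting [rho] off at B lowers the SIP polynomials, jumps being positive, so [M] still bounds
    them and the bounded case applies. At a fixed order the walk polynomial is a finite sum, so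
    pointwise convergence of the cut-off data is enough. *)
Lemma walk_le_sip (rho : S -> R) (M T : R) m x :
  (forall z, 0 <= rho z) -> 0 <= T ->
  (forall N, taylor sip N T (prodf rho) x <= M) ->
  expR (8 * n%:R * n%:R * T) * prodf (taylor walk m T rho) x <= M.
Proof.
move=> r0 T0 HM; set kappa := 8 * n%:R * n%:R.
pose rB (B : nat) z := minr (rho z) B%:R.
have rBP B z : 0 <= rB B z <= B%:R.
  by rewrite /rB le_min r0 ler0n/= ge_min lexx orbT.
have H (B : nat) : expR (kappa * T) * prodf (taylor walk m.+1 T (rB B)) x <= M.
  apply: (walk_le_sip_bounded _ (rBP B) T0) => N; apply: le_trans (HM N).
  apply: ler_sum => k _; rewrite ler_wpM2l ?divr_ge0 ?exprn_ge0//.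
  apply: iter_jump_le => [z|z].
    by have := sip_jumps_ge0 p_ge0 nb_supp nb_sum z.
  apply: prodf_le => u; have /andP[-> _] := rBP B u.
  by rewrite /rB ge_min lexx.
have rc z : rB B z @[B --> \oo] --> rho z.
  apply: cvg_near_cst; exists (truncn (rho z)).+1 => // B /= zB.
  apply/eqP; rewrite /rB eq_minl.
  by rewrite (le_trans (ltW (truncnS_gt _)))// ler_nat.
have cM : expR (kappa * T) * prodf (taylor walk m.+1 T (rB B)) x
    @[B --> \oo] --> expR (kappa * T) * prodf (taylor walk m.+1 T rho) x.
  apply: cvgMl_tmp; apply: prodf_cvg => z; exact: taylor_cvg.
apply: (@le_trans _ _ (expR (kappa * T) * prodf (taylor walk m.+1 T rho) x)).
  rewrite ler_wpM2l ?expR_ge0//; apply: prodf_le => z.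
  by rewrite walk_taylor_ge0//= walk_taylor_le.
rewrite -(cvg_lim _ cM)//; apply: limr_le; first by apply/cvg_ex; eexists; exact: cM.
exact: nearW.
Qed.

End Comparison.

(** * Gaussian product measures *)

Section WeightedPushforward.
Context {R : realType} {d1 d2 : measure_display}.
Context {Y : measurableType d1} {T : measurableType d2}.
Variables (mu : {measure set Y -> \bar R}) (nu : {measure set T -> \bar R}).
Variables (phi : Y -> T) (H : Y -> R) (C : R).
Hypothesis mphi : measurable_fun [set: Y] phi.
Hypothesis mH : measurable_fun [set: Y] H.
Hypothesis H_ge0 : forall y, 0 <= H y.

Hypothesis weightE : forall B, measurable B ->
  (\int[mu]_y (\1_B (phi y) * H y)%:E = C%:E * nu B)%E.

Import HBNNSimple.

Let weighted_nnsfun (h : {nnsfun T >-> R}) :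
  (\int[mu]_y (h (phi y) * H y)%:E = C%:E * \int[nu]_z (h z)%:E)%E.
Proof.
pose s := fset_set (range h).
have hE z : h z = \sum_(r <- s) r * \1_(h @^-1` [set r]) z.
  by rewrite fimfunE fsbig_finite.
have mB r : measurable (h @^-1` [set r]) by exact: measurable_sfunP.
have nn r z : 0 <= r * \1_(h @^-1` [set r]) z.
  by have := @nnfun_muleindic_ge0 _ T R h r z; rewrite lee_fin.
transitivity (\sum_(r <- s) (r%:E * (C%:E * nu (h @^-1` [set r]))))%E.
  under eq_integral do rewrite hE mulr_suml -sumEFin.
  rewrite ge0_integral_sum//=; last 2 first.
  - move=> r; apply/measurable_EFinP; apply: measurable_funM => //.
    by apply: measurable_funM => //; exact: measurableT_comp.
  - by move=> r y _; rewrite lee_fin mulr_ge0.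
  apply: eq_big_seq => r rs.
  under eq_integral do rewrite -mulrA EFinM.
  rewrite ge0_integralZl_EFin ?weightE//.
  - by move=> y _; rewrite lee_fin mulr_ge0.
  - apply/measurable_EFinP; apply: measurable_funM => //.
    exact: measurableT_comp.
  - move: rs; rewrite in_fset_set// inE => -[z _ <-]; exact: fun_ge0.
under [in RHS]eq_integral do rewrite hE -sumEFin.
rewrite ge0_integral_sum//=; last 2 first.
- by move=> r; apply/measurable_EFinP; exact: measurable_funM.
- by move=> r y _; rewrite lee_fin.
rewrite ge0_sume_distrr; last by move=> r _; apply: integral_ge0 => z _; rewrite lee_fin.
apply: eq_big_seq => r rs; rewrite muleCA; congr (_ * _)%E.
under eq_integral do rewrite EFinM.
rewrite ge0_integralZl_EFin ?integral_indic ?setIT//.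
- exact/measurable_EFinP.
- move: rs; rewrite in_fset_set// inE => -[z _ <-]; exact: fun_ge0.
Qed.

(** [weightE] is the case of indicators; simple functions and monotone convergence extend it. It is
    used both to integrate against a normal law through its density and to split one coordinate off
    a product measure. *)
Lemma weighted_pushforward (g : T -> R) :
  measurable_fun [set: T] g -> (forall z, 0 <= g z) ->
  (\int[mu]_y (g (phi y) * H y)%:E = C%:E * \int[nu]_z (g z)%:E)%E.
Proof.
move=> mg g0; have mEg : measurable_fun [set: T] (EFin \o g) by exact/measurable_EFinP.
pose h := nnsfun_approx measurableT mEg.
have hg z : (h n z)%:E @[n --> \oo] --> (g z)%:E.
  by apply: (@cvg_nnsfun_approx _ _ _ _ measurableT _ mEg) => //; move=> ? _; rewrite lee_fin.
have hnd n m z : (n <= m)%N -> h n z <= h m z.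
  by move=> nm; exact/lefP/nd_nnsfun_approx.
have L : (\int[mu]_y (h n (phi y) * H y)%:E @[n --> \oo] -->
    \int[mu]_y (g (phi y) * H y)%:E)%E.
  have -> : (\int[mu]_y (g (phi y) * H y)%:E =
      \int[mu]_y (limn (fun n => (h n (phi y) * H y)%:E)))%E.
    apply: eq_integral => y _; apply/esym/cvg_lim => //.
    under eq_fun do rewrite EFinM.
    by rewrite EFinM; apply: cvgeZr.
  apply: cvg_monotone_convergence => //.
  - move=> n; apply/measurable_EFinP; apply: measurable_funM => //.
    exact: measurableT_comp.
  - by move=> n y _; rewrite lee_fin mulr_ge0.
  - by move=> y _ n m nm; rewrite lee_fin ler_wpM2r// hnd.
have L2 : (\int[nu]_z (h n z)%:E @[n --> \oo] --> \int[nu]_z (g z)%:E)%E.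
  have -> : (\int[nu]_z (g z)%:E = \int[nu]_z (limn (fun n => (h n z)%:E)))%E.
    by apply: eq_integral => y _; apply/esym/cvg_lim.
  apply: cvg_monotone_convergence => //.
  - by move=> n; apply/measurable_EFinP.
  - by move=> n y _; rewrite lee_fin.
  - by move=> y _ n m nm; rewrite lee_fin hnd.
have L3 : (\int[mu]_y (h n (phi y) * H y)%:E @[n --> \oo] -->
    C%:E * \int[nu]_z (g z)%:E)%E.
  by under eq_fun do rewrite weighted_nnsfun; exact: cvgeZl.
exact: (cvg_unique _ L L3).
Qed.

End WeightedPushforward.

(** * Product functions under the Gaussian product measure *)

Section ProductGaussian.
Context {R : realType} {S : countType}.

Definition gaussian_measure (v : R) : {measure set (measurableTypeR R) -> \bar R} :=
  if v == 0 then (@dirac _ (measurableTypeR R) 0 R : {measure set _ -> \bar R})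
  else (normal_prob 0 (Num.sqrt v) : {measure set (measurableTypeR R) -> \bar R}).

Lemma gaussianE (v : R) A : gaussian v A = gaussian_measure v A.
Proof. by rewrite /gaussian /gaussian_measure; case: ifP. Qed.

Lemma gaussian_fin (v : R) A : measurable A -> gaussian v A \is a fin_num.
Proof.
move=> mA; rewrite /gaussian; case: ifP => _; last exact: fin_num_measure.
by rewrite diracE; case: (_ \in _).
Qed.

Lemma measurable_coord (x : S) :
  measurable_fun [set: conf R S] (fun eta : conf R S => eta x : measurableTypeR R).
Proof.
move=> _ B mB; rewrite setTI; apply: sub_sigma_algebra.
by exists x, B; split.
Qed.

Lemma measurable_rect (l : seq S) (B : S -> set (measurableTypeR R)) :
  (forall x, measurable (B x)) ->
  measurable [set eta : conf R S | forall x, x \in l -> B x (eta x)].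
Proof.
move=> mB; elim: l => [|x l IH].
  by rewrite (_ : [set _ | _] = setT)// -subTset => eta _ x; rewrite in_nil.
rewrite (_ : [set _ | _] = (fun eta : conf R S => eta x) @^-1` B x `&`
    [set eta : conf R S | forall x, x \in l -> B x (eta x)]).
  apply: measurableI => //; rewrite -[X in measurable X]setTI.
  exact: measurable_coord.
apply/seteqP; split => eta /=.
  by move=> H; split => [|z zl]; apply: H; rewrite in_cons ?eqxx// zl orbT.
by move=> [Hx H] z; rewrite in_cons => /predU1P[->//|]; exact: H.
Qed.

Context {rho : S -> R} {mu : probability (conf R S) R}.
Hypothesis hmu : product_gaussian rho mu.

Lemma product_gaussian_indic (l : seq S) (B : S -> set (measurableTypeR R)) :
  uniq l -> (forall x, measurable (B x)) ->
  (\int[mu]_eta (\prod_(x <- l) \1_(B x) (eta x))%:E =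
   (\prod_(x <- l) fine (gaussian (rho x) (B x)))%:E)%E.
Proof.
move=> ul mB.
have -> : (fun eta : conf R S => (\prod_(x <- l) \1_(B x) (eta x) : R)%:E) =
    (fun eta => (\1_[set eta : conf R S | forall x, x \in l -> B x (eta x)] eta)%:E).
  apply/funext => eta; congr (_%:E); rewrite indicE.
  have [/set_mem/= H|H] := boolP (eta \in _).
    by rewrite big1_seq// => x /andP[_ xl]; rewrite indicE mem_set//; exact: H.
  have [x xl nB] : exists2 x, x \in l & ~ B x (eta x).
    apply: contrapT => H'; move/negP: H; apply; apply/mem_set => x xl /=.
    by apply: contrapT => nB; apply: H'; exists x.
  by rewrite (bigD1_seq x)//= indicE memNset// mul0r.
rewrite integral_indic ?setIT//; last exact: measurable_rect.
have := hmu [fset x in l]%fset mB.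
rewrite (_ : [set eta : conf R S | _] =
    [set eta : conf R S | forall x, x \in l -> B x (eta x)]); last first.
  by apply/seteqP; split => eta /= H x xl; apply: H; rewrite ?inE// in xl *.
move=> muE; apply: (etrans muE).
rewrite (perm_big l)/=; last first.
  by apply: uniq_perm; rewrite ?fset_uniq// => z; rewrite inE.
elim: (l) => [|x s IH]; first by rewrite !big_nil.
by rewrite !big_cons IH EFinM fineK// gaussian_fin.
Qed.

(** The measure is known only on rectangles, so indicators are replaced by functions one coordinate
    at a time. The induction carries a second list [l2] of sites whose factor is still an
    indicator. *)
Lemma product_gaussian_integral (l : seq S) (g : S -> R -> R) (m : S -> R) :
  uniq l -> (forall x, measurable_fun [set: R] (g x)) ->
  (forall x a, 0 <= g x a) -> (forall x, 0 <= m x) ->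
  (forall x, (\int[gaussian_measure (rho x)]_a (g x a)%:E = (m x)%:E)%E) ->
  (\int[mu]_eta (\prod_(x <- l) g x (eta x))%:E = (\prod_(x <- l) m x)%:E)%E.
Proof.
move=> ul mg g0 m0 gm.
suff H l2 (B : S -> set (measurableTypeR R)) : uniq (l ++ l2) ->
    (forall x, measurable (B x)) ->
  (\int[mu]_eta (\prod_(x <- l) g x (eta x) *
                 \prod_(x <- l2) \1_(B x) (eta x))%:E =
   (\prod_(x <- l) m x *
    \prod_(x <- l2) fine (gaussian (rho x) (B x)))%:E)%E.
  have := H [::] (fun=> setT); rewrite cats0 => /(_ ul (fun=> measurableT)).
  under eq_integral do rewrite big_nil mulr1.
  by rewrite big_nil mulr1.
elim: l {ul} l2 B => [|x l IH] l2 B /= ul mB.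
  under eq_integral do rewrite big_nil mul1r.
  by rewrite big_nil mul1r product_gaussian_indic.
have /andP[xl ul'] := ul.
under eq_integral do rewrite big_cons -mulrA.
rewrite (@weighted_pushforward _ _ _ _ _ mu (gaussian_measure (rho x))
  (fun eta => eta x) (fun eta => \prod_(z <- l) g z (eta z) *
     \prod_(z <- l2) \1_(B z) (eta z))
  (\prod_(z <- l) m z * \prod_(z <- l2) fine (gaussian (rho z) (B z))))//.
- by rewrite gm -EFinM big_cons mulrC mulrA.
- exact: measurable_coord.
- apply: measurable_funM; apply: measurable_prod => z _.
    by apply: measurableT_comp => //; exact: measurable_coord.
  have mI : measurable_fun [set: measurableTypeR R] (\1_(B z) : _ -> R).
    exact: measurable_indic.
  exact: (measurableT_comp mI (measurable_coord z)).
- by move=> eta; apply: mulr_ge0; apply: prodr_ge0 => z _.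
(* The weight hypothesis at coordinate [x] is the induction hypothesis with [x] moved into [l2] and
   the set there taken to be [A]. *)
- move=> A mA; pose B' z := if z == x then A else B z.
  have xl2 : x \notin l2 by move: xl; rewrite mem_cat negb_or => /andP[].
  have B'x : B' x = A by rewrite /B' eqxx.
  have BB' (F : S -> set (measurableTypeR R) -> R) :
      \prod_(z <- l2) F z (B' z) = \prod_(z <- l2) F z (B z).
    apply: eq_big_seq => z zl2; rewrite /B'; case: eqP => // zx.
    by rewrite -zx zl2 in xl2.
  have := IH (x :: l2) B'; rewrite big_cons B'x.
  rewrite (BB' (fun z A => fine (gaussian (rho z) A))) => H.
  rewrite -gaussianE -[gaussian _ _]fineK ?gaussian_fin// -EFinM mulrAC -mulrA -H.
  + apply: eq_integral => eta _; congr (_%:E).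
    rewrite big_cons B'x (BB' (fun z A => \1_A (eta z))).
    by rewrite mulrCA.
  + by rewrite (perm_uniq (s2 := x :: l ++ l2))// perm_catC/= perm_cons perm_catC.
  + by move=> z; rewrite /B'; case: ifP.
- exact: mg.
Qed.

End ProductGaussian.

(** * Even moments of the normal law *)

Section GaussianMoments.
Context {R : realType}.
Local Notation mu := (@lebesgue_measure R).
Variable sigma : R.
Hypothesis sigma_gt0 : 0 < sigma.
Local Notation pdf := (normal_pdf 0 sigma).
Let v := sigma ^+ 2.

Let v_gt0 : 0 < v. Proof. exact: exprn_gt0. Qed.

Lemma is_derive_normal_pdf (x : R) :
  is_derive x (1 : R) pdf (- (x / v) * pdf x).
Proof.
have s0 : sigma != 0 by rewrite gt_eqF.
rewrite normal_pdfE// /normal_fun.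
have H : is_derive x (1 : R) (fun y : R => - (y - 0) ^+ 2 / (sigma ^+ 2 *+ 2)) (- (x / v)).
  rewrite (_ : (fun y : R => _) = - (sigma ^+ 2 *+ 2)^-1 *: (@id R) ^+ 2); last first.
    by apply/funext => y; rewrite /GRing.scale/= subr0 exprfctE mulNr [RHS]mulNr mulrC.
  apply: is_derive_eq; rewrite /GRing.scale/= /v; field.
  by rewrite s0.
rewrite (_ : (fun y => _) = normal_peak sigma *: (fun y => expR (- (y - 0) ^+ 2 / (sigma ^+ 2 *+ 2))))//.
apply: is_derive_eq
  (is_deriveZ (normal_peak sigma) (is_derive1_comp (is_derive_expR _) H)) _.
by rewrite /GRing.scale/=; ring.
Qed.

Let phi k (x : R) := x ^+ (2 * k) * pdf x.

Let phi_ge0 k x : 0 <= phi k x.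
Proof.
by rewrite /phi mulr_ge0 ?normal_pdf_ge0// exprM exprn_ge0// sqr_ge0.
Qed.

Let is_derive_expn n (x : R) :
  is_derive x (1 : R) (fun y : R => y ^+ n) (n%:R * x ^+ n.-1).
Proof.
rewrite (_ : (fun y : R => _) = (@id R) ^+ n); last by rewrite exprfctE.
by apply: is_derive_eq; rewrite /GRing.scale/= mulr1.
Qed.

Let continuous_phi k : continuous (phi k).
Proof.
move=> x; apply: is_derive_continuous.
exact: is_deriveM (is_derive_expn _ x) (is_derive_normal_pdf x).
Qed.

Let measurable_phi k : measurable_fun [set: R] (phi k).
Proof. exact: continuous_measurable_fun. Qed.

Let phi_integrable k (a b : R) : mu.-integrable `[a, b] (EFin \o phi k).
Proof.
apply: continuous_compact_integrable; first exact: segment_compact.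
exact: continuous_subspaceT.
Qed.

Let phi_integrableZ k (c a b : R) :
  mu.-integrable `[a, b] (fun x => (c * phi k x : R)%:E).
Proof.
suff : mu.-integrable `[a, b] (fun x => c%:E * (phi k x)%:E)%E by [].
by apply: integrableZl => //; exact: phi_integrable.
Qed.

Let phi_integralZ k (c a b : R) :
  (\int[mu]_(x in `[a, b]) (c * phi k x : R)%:E =
   c%:E * \int[mu]_(x in `[a, b]) (phi k x)%:E)%E.
Proof.
rewrite -integralZl//; exact: phi_integrable.
Qed.

Let phi_integral_fin k (a b : R) :
  (\int[mu]_(x in `[a, b]) (phi k x)%:E)%E \is a fin_num.
Proof. by apply: integrable_fin_num => //; exact: phi_integrable. Qed.

Let bdry k (N : nat) : R := - 2 * v * N%:R ^+ (2 * k).+1 * pdf N%:R.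

Let phi_by_parts k (N : nat) : (0 < N)%N ->
  (\int[mu]_(x in `[(- N%:R)%R, N%:R%R]) (phi k.+1 x)%:E =
   (v * (2 * k + 1)%N%:R)%:E * \int[mu]_(x in `[(- N%:R)%R, N%:R%R]) (phi k x)%:E +
   (bdry k N)%:E)%E.
Proof.
move=> N0; set c := (v * _)%R.
(* Suggested by pdf' = - (x / v) pdf. [G] is odd, so the two end points add up to the factor 2 in
   [bdry]. *)
pose G x := - v * x ^+ (2 * k).+1 * pdf x.
have dG (x : R) : is_derive x (1 : R) G (phi k.+1 x - c * phi k x).
  rewrite (_ : G = (- v *: (fun y : R => y ^+ (2 * k).+1)) * pdf); last first.
    by apply/funext => y; rewrite /G /GRing.scale.
  apply: is_derive_eq (is_deriveM (is_deriveZ (- v) (is_derive_expn _ x))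
    (is_derive_normal_pdf x)) _.
  rewrite /phi /c /GRing.scale/= mulnS !exprS addn1 /GRing.scale/=.
  by field; rewrite gt_eqF.
have NN : - N%:R < N%:R :> R by apply: (@lt_trans _ _ 0); rewrite ?oppr_lt0 ltr0n.
have cG x : {for x, continuous G} by exact: is_derive_continuous (dG x).
have C1 : {within `[- N%:R, N%:R], continuous (fun x => phi k.+1 x - c * phi k x)}.
  apply: continuous_subspaceT => x; apply: cvgB; first exact: continuous_phi.
  by apply: cvgMl_tmp; exact: continuous_phi.
have C2 : derivable_oo_LRcontinuous G (- N%:R) N%:R.
  split; first by move=> x _; have [] := dG x.
    exact/cvg_at_right_filter/cG.
  exact/cvg_at_left_filter/cG.
have C3 : {in `]- N%:R, N%:R[, derive1 G =1 (fun x => phi k.+1 x - c * phi k x)}.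
  by move=> x _; rewrite derive1E; have [_ ->] := dG x.
have := continuous_FTC2 NN C1 C2 C3.
under eq_integral do rewrite EFinB.
rewrite integralB//; last exact: phi_integrable.
rewrite phi_integralZ.
have f1 := phi_integral_fin k.+1 (- N%:R) N%:R.
have f2 := phi_integral_fin k (- N%:R) N%:R.
rewrite -(fineK f1) -(fineK f2) -!EFinM -!EFinB -EFinD => -[H]; congr (_%:E).
apply/eqP; rewrite addrC -subr_eq; apply/eqP; rewrite H /G /bdry.
rewrite normal_pdfE ?gt_eqF// /normal_fun !subr0 sqrrN.
by rewrite !exprS (exprM (- _)) sqrrN -exprM; ring.
Qed.

Let bdry_cvg k : bdry k N @[N --> \oo] --> 0.
Proof.
(* With y = N^2 / (2 v), the bound expR (- y) <= (k+1)! / y^(k+1) turns N^(2k+1) into 1 / N, which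
   is [harmonic N.-1]; [K] collects the constants. *)
pose K := 2 * v * normal_peak sigma * (k.+1`!%:R * (v *+ 2) ^+ k.+1).
apply: norm_cvg0.
apply: (@squeeze_cvgr _ _ _ _ (cst 0) (fun N => K * harmonic N.-1)); last 2 first.
- exact: cvg_cst.
- rewrite -(mulr0 K) -cvg_shiftS /=; apply: cvgMl_tmp; exact: cvg_harmonic.
exists 1%N => // N /= N1; rewrite normr_ge0/=.
have N0 : 0 < N%:R :> R by rewrite ltr0n.
rewrite /bdry normal_pdfE ?gt_eqF// /normal_fun subr0.
have -> : - (N%:R : R) ^+ 2 / (sigma ^+ 2 *+ 2) = - (N%:R ^+ 2 / (v *+ 2)).
  by rewrite mulNr.
set y := _ / _.
have y0 : 0 < y by rewrite divr_gt0 ?exprn_gt0// mulrn_wgt0.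
have ey : expR (- y) <= k.+1`!%:R / y ^+ k.+1.
  rewrite expRN -[leRHS]invrK invf_div lef_pV2 ?posrE ?expR_gt0//; last first.
    by rewrite divr_gt0 ?exprn_gt0// ltr0n fact_gt0.
  by apply: le_trans (expR_ge1Dxn k (ltW y0)); rewrite lerDr.
rewrite !mulNr normrN ger0_norm; last first.
  by rewrite !mulr_ge0 ?normal_peak_ge0 ?exprn_ge0 ?expR_ge0// ltW.
rewrite mulrA; apply: le_trans (ler_wpM2l _ ey) _.
  by rewrite !mulr_ge0 ?normal_peak_ge0 ?exprn_ge0// ltW.
rewrite le_eqVlt; apply/orP; left; apply/eqP.
rewrite /K /harmonic/= prednK// /y expr_div_n invf_div -exprM mulnS exprD exprS [in RHS]exprS exprS.
have NN : N%:R != 0 :> R by rewrite gt_eqF.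
by field; rewrite ?expf_neq0 ?NN.
Qed.

Lemma integral_even_moment_pdf k :
  (\int[mu]_x (x ^+ (2 * k) * pdf x)%:E = ((odd_dfact k)%:R * v ^+ k)%:E)%E.
Proof.
elim: k => [|k IH].
  under eq_integral do rewrite muln0 expr0 mul1r.
  by rewrite integral_normal_pdf /odd_dfact big_ord0 expr0 mulr1.
pose F (N : nat) : set R := `[- N%:R, N%:R]%classic.
have F1 : nondecreasing_seq F.
  move=> n m nm; rewrite subsetEset; apply: subset_itv; rewrite bnd_simp.
    by rewrite lerN2 ler_nat.
  by rewrite ler_nat.
have F2 N : measurable (F N) by exact: measurable_itv.
have F3 : \bigcup_N F N = setT.
  rewrite -subTset => x _; exists (truncn `|x|).+1 => //.
  by rewrite /F /= in_itv/= -ler_norml ltW// truncnS_gt.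
have H j : (\int[mu]_(x in F N) (phi j x)%:E @[N --> \oo] -->
    \int[mu]_x (phi j x)%:E)%E.
  rewrite -F3; apply: ge0_nondecreasing_set_cvg_integral => //.
  - move=> N; apply/measurable_EFinP; apply: measurable_funTS; exact: measurable_phi.
  - by move=> N x _; rewrite lee_fin.
have H2 : (\int[mu]_(x in F N) (phi k.+1 x)%:E @[N --> \oo] -->
    (v * (2 * k + 1)%N%:R)%:E * ((odd_dfact k)%:R * v ^+ k)%:E + 0%:E)%E.
  rewrite -(cvg_shiftS _) /=.
  under eq_fun do rewrite phi_by_parts//.
  have L1 : ((v * (2 * k + 1)%N%:R)%:E * \int[mu]_(x in F N.+1) (phi k x)%:E
      @[N --> \oo] -->
      (v * (2 * k + 1)%N%:R)%:E * ((odd_dfact k)%:R * v ^+ k)%:E)%E.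
    apply: cvgeZl => //; rewrite -IH.
    by have := H k; rewrite -(cvg_shiftS _).
  have L2 : ((bdry k N.+1)%:E @[N --> \oo] --> 0%:E)%E.
    apply/cvg_EFin; first exact: nearW.
    by rewrite (cvg_shiftS (bdry k)); exact: bdry_cvg.
  exact: cvgeD L1 L2.
rewrite (cvg_unique _ (H k.+1) H2)// adde0 -EFinM; congr (_%:E).
by rewrite odd_dfactS natrM exprS; ring.
Qed.

End GaussianMoments.

Lemma gaussian_even_moment {R : realType} (r : R) k : 0 <= r ->
  (\int[gaussian_measure r]_a (a ^+ (2 * k) / (odd_dfact k)%:R)%:E =
   (r ^+ k)%:E)%E.
Proof.
move=> r0; rewrite /gaussian_measure; case: eqP => [->|/eqP rn].
  rewrite integral_dirac//; last first.
    by apply/measurable_EFinP; apply: measurable_funM => //; exact: measurable_funX.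
  rewrite diracT mul1e; case: k => [|k].
    by rewrite muln0 !expr0 /odd_dfact big_ord0 divr1.
  by rewrite mulnS !exprS !mul0r.
have rp : 0 < r by rewrite lt_def rn.
have sp : 0 < Num.sqrt r by rewrite sqrtr_gt0.
have mx : measurable_fun [set: R] (fun a : R => a ^+ (2 * k) / (odd_dfact k)%:R).
  by apply: measurable_funM => //; exact: measurable_funX.
have g0 (a : R) : 0 <= a ^+ (2 * k) / (odd_dfact k)%:R.
  by rewrite divr_ge0// exprM exprn_ge0// sqr_ge0.
have := @weighted_pushforward R _ _ _ _ lebesgue_measure
  (normal_prob 0 (Num.sqrt r)) (fun x => x) (normal_pdf 0 (Num.sqrt r)) 1 _ _ _ _
  _ mx g0.
rewrite mul1e => <- //.
- transitivity (((odd_dfact k)%:R^-1)%:E * ((odd_dfact k)%:R * (Num.sqrt r ^+ 2) ^+ k)%:E)%E.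
    rewrite -integral_even_moment_pdf// -ge0_integralZl_EFin//.
    + by apply: eq_integral => x _; rewrite -EFinM; congr (_%:E); ring.
    + by move=> x _; rewrite lee_fin mulr_ge0 ?normal_pdf_ge0// exprM exprn_ge0// sqr_ge0.
    + apply/measurable_EFinP; apply: measurable_funM; first exact: measurable_funX.
      exact: measurable_normal_pdf.
  rewrite sqr_sqrtr// -EFinM mulrA mulVf ?mul1r//.
  by rewrite pnatr_eq0 -lt0n odd_dfact_gt0.
- exact: measurable_normal_pdf.
- by move=> y; exact: normal_pdf_ge0.
- move=> B mB; rewrite mul1e /normal_prob [RHS]integral_mkcond.
  apply: eq_integral => x _; rewrite patchE indicE.
  by case: (x \in B); rewrite ?mul1r ?mul0r.
Qed.

Section GaussianDuality.
Context {R : realType} {S : countType}.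
Variables (rho : S -> R) (mu : probability (conf R S) R).
Hypothesis rho_ge0 : forall x, 0 <= rho x.
Hypothesis hmu : product_gaussian rho mu.

(** The double factorials in [D] cancel those of the Gaussian moments, leaving [rho] to the
    occupation number at each site; regrouped by labels this is a product function, the form that
    the comparison requires. *)
Lemma integral_D_particles n (x : 'I_n -> S) :
  (\int[mu]_eta (D (particles x) eta)%:E = (\prod_i rho (x i))%:E)%E.
Proof.
pose A := undup (codom x).
have uA : uniq A by exact: undup_uniq.
have xA i : x i \in A by rewrite mem_undup codom_f.
have H z : z \notin A -> particles x z = 0%N.
  by rewrite mem_undup => /particles_notin.
under eq_integral do rewrite (D_prod _ uA H).
rewrite (@product_gaussian_integral _ _ _ _ hmu A
  (fun z a => a ^+ (2 * particles x z) / (odd_dfact (particles x z))%:R)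
  (fun z => rho z ^+ particles x z))//.
- congr (_%:E); rewrite /particles.
  under eq_bigr do rewrite -prodrXr.
  rewrite exchange_big/=; apply: eq_bigr => i _.
  rewrite (bigD1_seq (x i))//= /delta eqxx expr1 big1 ?mulr1// => z zx.
  by rewrite eq_sym (negbTE zx) expr0.
- by move=> z; apply: measurable_funM => //; exact: measurable_funX.
- by move=> z a; rewrite divr_ge0// exprM exprn_ge0// sqr_ge0.
- by move=> z; rewrite exprn_ge0.
- by move=> z; exact: gaussian_even_moment.
Qed.

End GaussianDuality.

(** * Integration over the initial configuration *)

Section Neighbours.
Context {R : realType}.

Lemma finite_neighbours (s : site_space) (p : sites s -> sites s -> R) x :
  admissible p -> finite_set [set y | p x y != 0].
Proof.
case: s p x => [T|d] p x [_ hp]; first exact: (@finite_finset T).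
case: hp => _ [r [r0 pr]].
pose N := (truncn r).+1.
(* A coordinate of [x - y] is at most its Euclidean norm, hence less than [N] in absolute value; [f]
   records these coordinates shifted by [N]. *)
pose h (f : {ffun 'I_d -> 'I_(2 * N).+1}) : 'rV[int]_d :=
  \row_i (x ord0 i + N%:Z - (f i)%:Z).
apply: (@sub_finite_set _ _ (h @` setT)); last first.
  by apply: finite_image; exact: finite_finset.
move=> y /= pxy.
have xyr : euclid_norm R (x - y) <= r.
  by rewrite leNgt; apply: contra pxy => /pr ->.
have zN i : `|(x - y) ord0 i| < N%:Z.
  rewrite -(ltr_int R) intr_norm.
  apply: (@le_lt_trans _ _ r); last by rewrite /N truncnS_gt.
  apply: le_trans xyr; rewrite /euclid_norm -sqrtr_sqr ler_wsqrtr//.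
  rewrite (bigD1 i)//= lerDl; apply: sumr_ge0 => j _; exact: sqr_ge0.
have ltN i : (absz (N%:Z + (x - y) ord0 i)%R < (2 * N).+1)%N.
  by have := zN i; lia.
exists [ffun i => Ordinal (ltN i)] => //.
apply/rowP => i; rewrite !mxE ffunE/= -[0]/ord0.
have := zN i; rewrite !mxE (_ : y 0 i = y ord0 i)//.
by move: (x ord0 i) (y ord0 i) => a b; lia.
Qed.

Lemma neighbours_exist (s : site_space) (p : sites s -> sites s -> R) :
  admissible p -> exists nb : sites s -> seq (sites s),
  [/\ forall x, uniq (nb x),
      forall x y, y \notin nb x -> p x y = 0 &
      forall x, \sum_(y <- nb x) p x y = 1].
Proof.
move=> hp; have fin x := finite_neighbours x hp.
exists (fun x => fset_set [set y | p x y != 0]); split.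
- by move=> x; exact: fset_uniq.
- by move=> x y; apply: contraNeq => pxy; rewrite in_fset_set//; exact/mem_set.
- move=> x; apply: EFin_inj; have [hw _] := hp.
  rewrite -(walk_sum1 hw x) -sumEFin.
  rewrite (_ : \esum_(y in [set: sites s]) (p x y)%:E =
     \esum_(y in [set y | (p x y != 0)%R]) (p x y)%:E)%E.
    rewrite esum_fset//; first by rewrite fsbig_finite.
    by move=> y _; rewrite lee_fin; exact: walk_ge0 hw x y.
  rewrite [RHS]esum_mkcond; apply: eq_esum => y _.
  by case: ifPn => //; rewrite notin_setE/= => /negP; rewrite negbK => /eqP ->.
Qed.

End Neighbours.

(** * Products of monotone limits in the extended reals *)

Section ProductLimits.
Context {R : realType}.
Local Open Scope ereal_scope.

Lemma nd_ge0_cvg0 (a : (\bar R)^nat) : nondecreasing_seq a ->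
  (forall m, 0 <= a m) -> a @ \oo --> 0 -> forall m, a m = 0.
Proof.
move=> nda a0 ca m; apply/eqP; rewrite eq_le a0 andbT.
rewrite -(cvg_unique _ (ereal_nondecreasing_cvgn nda) ca)//.
by apply: ereal_sup_ubound; exists m.
Qed.

(** Limits may be infinite, so 0 times [+oo] must be excluded. Monotonicity does it: a nonnegative
    nondecreasing sequence with limit 0 is identically 0. *)
Lemma nd_prod_cvg I (s : seq I) (a : I -> (\bar R)^nat) (l : I -> \bar R) :
  (forall i, nondecreasing_seq (a i)) -> (forall i m, 0 <= a i m) ->
  (forall i, a i @ \oo --> l i) ->
  \prod_(i <- s) a i m @[m --> \oo] --> \prod_(i <- s) l i.
Proof.
move=> nda a0 al; elim: s => [|i s IH].
  by under eq_fun do rewrite big_nil; rewrite big_nil; exact: cvg_cst.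
pose b m := \prod_(j <- s) a j m.
rewrite big_cons (_ : (fun m => _) = (fun m => a i m * b m)); last first.
  by apply/funext => m; rewrite big_cons.
have b0 m : 0 <= b m by apply: prode_ge0 => j _.
have ndb : nondecreasing_seq b.
  move=> m n mn; rewrite /b; elim: (s) => [|j u IHu]; first by rewrite !big_nil.
  by rewrite !big_cons; apply: lee_pmul => //; [apply: prode_ge0 => ? _|exact: nda].
have l0 : 0 <= l i by rewrite -(cvg_lim _ (al i))//; apply: lime_ge; [exact: cvgP (al i)|exact: nearW].
have lb0 : 0 <= \prod_(j <- s) l j.
  by rewrite -(cvg_lim _ IH)//; apply: lime_ge; [exact: cvgP IH|exact: nearW].
have [li0|li0] := eqVneq (l i) 0.
  have ai : forall m, a i m = 0 by apply: nd_ge0_cvg0 => //; rewrite -li0.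
  rewrite (_ : (fun m => _) = cst 0) ?li0 ?mul0e; last first.
    by apply/funext => m; rewrite ai mul0e.
  exact: cvg_cst.
have [lb|lb] := eqVneq (\prod_(j <- s) l j) 0.
  have bz : forall m, b m = 0 by apply: nd_ge0_cvg0 => //; rewrite -lb.
  rewrite (_ : (fun m => _) = cst 0) ?lb ?mule0; last first.
    by apply/funext => m; rewrite bz mule0.
  exact: cvg_cst.
have dlb : l i *? \prod_(j <- s) l j by rewrite mule_defE (negbTE li0) (negbTE lb).
exact: cvgeM dlb (al i) IH.
Qed.

End ProductLimits.

Section MixtureIntegral.
Context d1 d2 (X : measurableType d1) (Omega : measurableType d2)
  (R : realType).
Variables (mu : probability X R) (Pr : X -> probability Omega R).
Variable mPr : forall C : set Omega, measurable C ->
  measurable_fun [set: X] (fun eta => Pr eta C).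
Local Open Scope ereal_scope.

(** The mixture is the bind of the Giry monad applied to [mu] and the kernel, whose integration
    formula is then available. *)
Lemma integral_mixture (h : Omega -> \bar R) :
  measurable_fun [set: Omega] h -> (forall w, 0 <= h w) ->
  \int[mixture mu mPr]_w h w = \int[mu]_eta \int[Pr eta]_w h w.
Proof.
move=> mh h0.
pose f (x : X) : giry Omega R := Pr x.
have mf : measurable_fun [set: X] f by exact: measurable_giry_codensity.
rewrite -[RHS](@giry_int_bind _ _ _ _ _ mu f mf h mh h0).
apply: eq_measure_integral => A mA _.
rewrite /mixture /giry_bind/= [RHS](_ : _ =
  \int[giry_map mf mu]_m giry_ev m A)//.
rewrite [RHS]giry_int_map//.
exact: measurable_giry_ev.
Qed.

End MixtureIntegral.

(** * Exchange of integrals and Taylor polynomials *)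

Section IntegralTaylor.
Context {R : realType} {d : measure_display} {X : measurableType d}.
Variable mu : {measure set X -> \bar R}.
Context {E : Type} (G : E -> seq (R * E)).
Hypothesis G_ge0 : forall x, all (fun r : R * E => 0 <= r.1) (G x).

(** Nonnegativity is bundled with the value so that finite positive combinations, in particular
    [jump G], commute with the integral. *)
Definition integrates_to (f : E -> X -> R) (F : E -> R) : Prop :=
  forall x, [/\ measurable_fun [set: X] (f x), forall eta, 0 <= f x eta &
    (\int[mu]_eta (f x eta)%:E = (F x)%:E)%E].

Lemma integrates_to_jump f F : integrates_to f F ->
  integrates_to (fun x eta => jump G (f ^~ eta) x) (jump G F).
Proof.
move=> fF x; rewrite /jump; have := G_ge0 x.
elim: (G x) => [_|r l IH /= /andP[r0 /IH[ml l0 lF]]].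
  split.
  - by under eq_fun do rewrite big_nil; exact: measurable_cst.
  - by move=> eta; rewrite big_nil.
  - by under eq_integral do rewrite big_nil; rewrite big_nil integral0.
have [mf f0 fi] := fF r.2.
split.
- under eq_fun do rewrite big_cons.
  by apply: measurable_funD => //; exact: measurable_funM.
- by move=> eta; rewrite big_cons addr_ge0// mulr_ge0.
- under eq_integral do rewrite big_cons EFinD.
  rewrite ge0_integralD//; first last.
  + exact/measurable_EFinP.
  + by move=> eta _; rewrite lee_fin.
  + by apply/measurable_EFinP; exact: measurable_funM.
  + by move=> eta _; rewrite lee_fin mulr_ge0.
  rewrite lF big_cons EFinD; congr (_ + _)%E.
  under eq_integral do rewrite EFinM.
  rewrite ge0_integralZl_EFin ?fi//; last exact/measurable_EFinP.
  by move=> eta _; rewrite lee_fin.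
Qed.

Lemma integrates_to_iter_jump f F k : integrates_to f F ->
  integrates_to (fun x eta => iter k (jump G) (f ^~ eta) x) (iter k (jump G) F).
Proof. by move=> fF; elim: k => // k IH; exact: integrates_to_jump IH. Qed.

Lemma integrates_toZ f F a : 0 <= a -> integrates_to f F ->
  integrates_to (fun x eta => a * f x eta) (fun x => a * F x).
Proof.
move=> a0 fF x; have [mf f0 fi] := fF x; split.
- exact: measurable_funM.
- by move=> eta; rewrite mulr_ge0.
- under eq_integral do rewrite EFinM.
  rewrite ge0_integralZl_EFin ?fi//; last exact/measurable_EFinP.
  by move=> eta _; rewrite lee_fin.
Qed.

Lemma integrates_to_taylor f F N t : 0 <= t -> integrates_to f F ->
  integrates_to (fun x eta => taylor G N t (f ^~ eta) x) (taylor G N t F).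
Proof.
move=> t0 fF; elim: N => [|N IH] x.
  split.
  - by under eq_fun do rewrite /taylor big_ord0; exact: measurable_cst.
  - by move=> eta; rewrite /taylor big_ord0.
  - by under eq_integral do rewrite /taylor big_ord0; rewrite /taylor big_ord0 integral0.
have [m1 g1 i1] := IH x.
have tN : 0 <= t ^+ N / N`!%:R by rewrite divr_ge0 ?exprn_ge0.
have [m2 g2 i2] := integrates_toZ tN (integrates_to_iter_jump N fF) x.
split.
- by under eq_fun do rewrite taylorS; exact: measurable_funD.
- by move=> eta; rewrite taylorS addr_ge0.
- under eq_integral do rewrite taylorS EFinD.
  rewrite ge0_integralD//; first last.
  + exact/measurable_EFinP.
  + by move=> eta _; rewrite lee_fin.
  + exact/measurable_EFinP.
  + by move=> eta _; rewrite lee_fin.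
  by rewrite i1 i2 taylorS EFinD.
Qed.

End IntegralTaylor.

Section MeasurableD.
Context {R : realType} {S : countType}.

Lemma measurable_D (A : seq S) (xi : S -> nat) :
  (forall z, z \notin A -> xi z = 0%N) ->
  measurable_fun [set: conf R S] (D xi : conf R S -> R).
Proof.
move=> H; rewrite (D_monomial (A := undup A)) ?undup_uniq//; last first.
  by move=> z; rewrite mem_undup; exact: H.
apply: measurable_funM => //; apply: measurable_prod => z _.
by apply: measurable_funX; exact: measurable_coord.
Qed.

End MeasurableD.

(** * The correlation inequality for moments *)

Section CorrelationInequality.
Context {R : realType} {S : countType} {dO : measure_display}.
Context {Omega : measurableType dO}.
Context {Pr : conf R S -> probability Omega R}.
Context {eta_ : R -> {mfun Omega >-> conf R S}} {p : S -> S -> R}.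
Context {X0 : set (conf R S)} (bmp : BMP Pr eta_ p X0).
Variable nb : S -> seq S.
Hypothesis p_sym : forall x y, p x y = p y x.
Hypothesis p_ge0 : forall x y, 0 <= p x y.
Hypothesis p_diag : forall x, p x x = 0.
Hypothesis nb_uniq : forall x, uniq (nb x).
Hypothesis nb_supp : forall x y, y \notin nb x -> p x y = 0.
Hypothesis nb_sum : forall x, \sum_(y <- nb x) p x y = 1.
Variables (rho : S -> R) (mu : probability (conf R S) R).
Hypothesis rho_ge0 : forall x, 0 <= rho x.
Hypothesis hmu : product_gaussian rho mu.
Hypothesis hX0 : mu X0 = 1%E.
Variable t : R.
Hypothesis t_ge0 : 0 <= t.

Lemma expectation_integral (f : conf R S -> R) eta :
  ('E_(Pr eta)[f \o eta_ t] = \int[Pr eta]_w (f (eta_ t w))%:E)%E.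
Proof. by rewrite unlock. Qed.

Lemma measurable_expectation (f : conf R S -> R) :
  measurable_fun [set: conf R S] f -> (forall eta, 0 <= f eta) ->
  measurable_fun [set: conf R S] (fun eta => 'E_(Pr eta)[f \o eta_ t]%E).
Proof.
move=> mf f0.
have -> : (fun eta => 'E_(Pr eta)[f \o eta_ t])%E =
    (fun eta => \int[Pr eta]_w (f (eta_ t w))%:E)%E.
  by apply/funext => eta; exact: expectation_integral.
apply: measurable_fun_integral_kernel => //.
- exact: BMP_kernel bmp.
- by move=> w; rewrite lee_fin.
- apply/measurable_EFinP; exact: measurableT_comp mf (measurable_funP (eta_ t)).
Qed.

(** Duality holds only for starting points in [X0], so both integrals are restricted to this set of
    full measure before integrands are compared. *)
Lemma integral_X0 (f : conf R S -> \bar R) :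
  measurable_fun [set: conf R S] f -> (forall eta, (0 <= f eta)%E) ->
  (\int[mu]_eta f eta = \int[mu]_(eta in X0) f eta)%E.
Proof.
move=> mf f0; have mX0 := BMP_states bmp.
rewrite (@ge0_negligible_integral _ _ _ mu setT (~` X0))//.
- by rewrite setDE setTI setCK.
- exact: measurableC.
- by have := probability_setC mu mX0; rewrite hX0 subee.
Qed.

Lemma particles_integrates n :
  integrates_to mu (fun x : 'I_n -> S => D (particles x)) (prodf rho).
Proof.
move=> x; split.
- by apply: (@measurable_D _ _ (codom x)) => z; exact: particles_notin.
- by move=> eta; apply: (@D_ge0 _ _ (codom x)) => z; exact: particles_notin.
- exact: integral_D_particles.
Qed.

Lemma delta_integrates :
  integrates_to mu (fun x : S => D (delta x)) rho.
Proof.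
move=> x; rewrite delta_particles.
have [mx gx ->] := @particles_integrates 1 (fun=> x).
by split => //; rewrite /prodf big_ord1.
Qed.

Lemma sip_moment_lower n (x : 'I_n -> S) N :
  ((expR (- (sip_rate n * t)) *
    taylor (@sip_jumps _ _ p nb n) N t (prodf rho) x)%:E <=
   \int[mu]_eta 'E_(Pr eta)[D (particles x) \o eta_ t])%E.
Proof.
have G0 z := sip_jumps_ge0 p_ge0 nb_supp nb_sum (n := n) z.
have [m1 g1 <-] := integrates_toZ (expR_ge0 (- (sip_rate n * t)))
  (integrates_to_taylor G0 N t_ge0 (@particles_integrates n)) x.
have [mx gx _] := @particles_integrates n x.
have g2 eta : (0 <= 'E_(Pr eta)[D (particles x) \o eta_ t])%E.
  by apply: expectation_ge0 => w /=.
rewrite [leLHS]integral_X0; last 2 first.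
- exact/measurable_EFinP.
- by move=> eta; rewrite lee_fin.
rewrite [leRHS]integral_X0//; last exact: measurable_expectation.
have mX0 := BMP_states bmp.
apply: ge0_le_integral => //.
- by move=> eta _; rewrite lee_fin.
- apply: measurable_funTS; exact/measurable_EFinP.
- apply: measurable_funTS; exact: measurable_expectation.
move=> eta eX0.
have sm (z : 'I_n -> S) : smooth_local (D (particles z) : conf R S -> R).
  by apply: (@smooth_local_D _ _ (codom z)) => u; exact: particles_notin.
have D0 (z : 'I_n -> S) zeta : 0 <= D (particles z) zeta :> R.
  by have [_ + _] := @particles_integrates n z.
have gen z zeta := gen_sip p_sym p_diag nb_uniq nb_supp nb_sum (n := n) z zeta.
rewrite (expectation_dual_fin bmp sm eX0 x t_ge0) lee_fin.
exact: (duality_taylor_lower bmp sm D0 gen eX0 N x t_ge0 G0).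
Qed.

(** At each starting point in [X0] the Taylor polynomials increase to the expectation, so monotone
    convergence gives the limit even if it is infinite. *)
Lemma walk_moment_cvg x :
  (expR (- (4 * t)) * taylor (walk_jumps p nb) N t rho x)%:E @[N --> \oo] -->
  (\int[mu]_eta 'E_(Pr eta)[D (delta x) \o eta_ t])%E.
Proof.
have G0 z := walk_jumps_ge0 nb p_ge0 z.
have iN N := integrates_toZ (expR_ge0 (- (4 * t)))
  (integrates_to_taylor G0 N t_ge0 delta_integrates) x.
have [mx gx _] := delta_integrates x.
have g2 eta : (0 <= 'E_(Pr eta)[D (delta x) \o eta_ t])%E.
  by apply: expectation_ge0 => w /=.
have mX0 := BMP_states bmp.
pose g N (eta : conf R S) :=
  (expR (- (4 * t)) * taylor (walk_jumps p nb) N t (fun z => D (delta z) eta) x)%:E.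
have -> : (fun N => (expR (- (4 * t)) * taylor (walk_jumps p nb) N t rho x)%:E) =
    (fun N => \int[mu]_(eta in X0) g N eta)%E.
  apply/funext => N; have [mN gN <-] := iN N.
  rewrite [LHS]integral_X0//; exact/measurable_EFinP.
rewrite integral_X0//; last exact: measurable_expectation.
rewrite (_ : (\int[mu]_(eta in X0) 'E_(Pr eta)[D (delta x) \o eta_ t])%E =
  (\int[mu]_(eta in X0) limn (g ^~ eta))%E).
  apply: cvg_monotone_convergence => //.
  - move=> N; have [mN gN _] := iN N.
    apply: measurable_funTS; exact/measurable_EFinP.
  - by move=> N eta _; have [_ gN _] := iN N; rewrite lee_fin.
  - move=> eta _ m n mn; rewrite lee_fin ler_wpM2l ?expR_ge0//.
    elim: n mn => [|n IH]; first by rewrite leqn0 => /eqP ->.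
    rewrite leq_eqVlt => /predU1P[->//|mn].
    apply: (le_trans (IH mn)); apply: walk_taylor_le => // z.
    by have [_ + _] := delta_integrates z.
apply: eq_integral => eta /set_mem eX0.
have supp (z u : S) : u \notin [:: z] -> delta z u = 0%N.
  by rewrite inE eq_sym /delta => /negbTE ->.
have sm z : smooth_local (D (delta z) : conf R S -> R).
  by apply: (@smooth_local_D _ _ [:: z]); exact: supp.
have D0 (z : S) zeta : 0 <= D (delta z) zeta :> R.
  by have [_ + _] := delta_integrates z.
have gen z zeta := gen_walk p_sym p_diag nb_uniq nb_supp nb_sum z zeta.
rewrite (expectation_dual_fin bmp sm eX0 x t_ge0); apply/esym/cvg_lim => //.
apply/cvg_EFin; first exact: nearW.
exact: (duality_taylor_cvg bmp sm D0 gen eX0 t_ge0 G0).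
Qed.

Lemma moment_inequality n (x : 'I_n -> S) :
  (\prod_(i < n) \int[mu]_eta 'E_(Pr eta)[D (delta (x i)) \o eta_ t]
   <= \int[mu]_eta 'E_(Pr eta)[D (particles x) \o eta_ t])%E.
Proof.
have M0 : (0 <= \int[mu]_eta 'E_(Pr eta)[D (particles x) \o eta_ t])%E.
  apply: integral_ge0 => eta _; apply: expectation_ge0 => w /=.
  by have [_ + _] := @particles_integrates n x.
have low := sip_moment_lower x.
move: (\int[mu]_eta 'E_(Pr eta)[D (particles x) \o eta_ t])%E M0 low => M M0 low.
(* An infinite moment makes the claim trivial. A finite one bounds all SIP polynomials after
   multiplication by the exponential, as [walk_le_sip] requires. *)
case: M M0 low => [M| |//] _ low; last by rewrite leey.
pose a i N := (expR (- (4 * t)) * taylor (walk_jumps p nb) N t rho (x i))%:E.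
have tg N z : 0 <= taylor (walk_jumps p nb) N t rho z by exact: walk_taylor_ge0.
have a0 i N : (0 <= a i N)%E by rewrite lee_fin mulr_ge0 ?expR_ge0.
have nda i : nondecreasing_seq (a i).
  apply/nondecreasing_seqP => N; rewrite lee_fin ler_wpM2l ?expR_ge0//.
  exact: walk_taylor_le.
have cv := nd_prod_cvg (s := index_enum 'I_n) nda a0 (fun i => @walk_moment_cvg (x i)).
rewrite -(cvg_lim _ cv)//; apply: lime_le; first exact: cvgP cv.
apply: nearW => N; rewrite /a prodEFin lee_fin.
rewrite big_split/= prodr_const card_ord -expRM_natl -/(prodf _ x).
have cmp : expR (8 * n%:R * n%:R * t) *
    prodf (taylor (walk_jumps p nb) N t rho) x <= expR (sip_rate n * t) * M.
  apply: (walk_le_sip p_sym p_ge0 nb_supp nb_sum N rho_ge0 t_ge0) => k.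
  by rewrite -ler_pdivrMl ?expR_gt0// -expRN -lee_fin.
(* The exponents match because [sip_rate n] minus 8 n^2 is 4 n, the total rate of n independent
   walks. *)
move: cmp; rewrite -ler_pdivrMl ?expR_gt0// -expRN mulrA -expRD.
congr (_ * _ <= _); congr (expR _); rewrite /sip_rate; ring.
Qed.

End CorrelationInequality.

(** * From moments to positive correlation *)

Section PositiveCorrelation.
Context {R : realType} {S : countType} {dO : measure_display}.
Context {Omega : measurableType dO}.
Context {Pr : conf R S -> probability Omega R}.
Context {eta_ : R -> {mfun Omega >-> conf R S}} {p : S -> S -> R}.
Context {X0 : set (conf R S)} (bmp : BMP Pr eta_ p X0).
Variables (mu : probability (conf R S) R) (t : R).
Local Open Scope ereal_scope.

Lemma expectation_law_at (f : conf R S -> R) :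
  measurable_fun [set: conf R S] f -> (forall eta, (0 <= f eta)%R) ->
  'E_(law_at bmp mu t)[f] = \int[mu]_eta 'E_(Pr eta)[f \o eta_ t].
Proof.
move=> mf f0; rewrite {1}unlock /law_at.
rewrite ge0_integral_distribution//; last exact/measurable_EFinP.
rewrite integral_mixture; last 2 first.
- have mEf : measurable_fun [set: conf R S] (EFin \o f) by exact/measurable_EFinP.
  exact: (measurableT_comp mEf (measurable_funP (eta_ t))).
- by move=> w; rewrite lee_fin.
by apply: eq_integral => eta _; rewrite unlock.
Qed.

Lemma D_delta (x : S) (eta : conf R S) : D (delta x) eta = (eta x ^+ 2)%R.
Proof.
have H z : z \notin [:: x] -> delta x z = 0%N.
  by rewrite inE eq_sym /delta => /negbTE ->.
rewrite (D_prod _ _ H)// big_seq1 /delta eqxx muln1.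
by rewrite /odd_dfact big_ord1 muln0 add0n divr1.
Qed.

(** Equality holds at distinct sites. At a common site [D] carries the factor 1 / 3!! = 1 / 3, and
    dropping it goes in the useful direction. *)
Lemma D_pair_le (x : 'I_2 -> S) (eta : conf R S) :
  (D (particles x) eta <= eta (x ord0) ^+ 2 * eta (x ord_max) ^+ 2)%R.
Proof.
have H z : z \notin undup (codom x) -> particles x z = 0%N.
  by rewrite mem_undup; exact: particles_notin.
have [xy|xy] := eqVneq (x ord0) (x ord_max).
  have xc (k : 'I_2) : x k = x ord0.
    have /orP[/eqP->//|/eqP->//] : (k == ord0) || (k == ord_max).
    by case: k => [[|[|//]] ?].
  have H1 z : z \notin [:: x ord0] -> particles x z = 0%N.
    rewrite inE => zx; apply: particles_notin.
    by apply: contra zx => /codomP[k ->]; rewrite xc.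
  rewrite (D_prod _ _ H1)// big_seq1 -xy.
  have -> : particles x (x ord0) = 2%N.
    rewrite /particles (eq_bigr (fun=> 1%N)) ?sum_nat_const ?card_ord//.
    by move=> k _; rewrite xc /delta eqxx.
  rewrite /odd_dfact !big_ord_recl big_ord0 /= -exprD.
  rewrite ler_pdivrMr ?ltr0n// ler_peMr ?ler1n//.
  by rewrite exprM sqr_ge0.
have H2 z : z \notin [:: x ord0; x ord_max] -> particles x z = 0%N.
  rewrite !inE negb_or => /andP[z0 z1]; apply: particles_notin.
  apply/codomP => -[k zk].
  have : (k == ord0) || (k == ord_max) by case: k {zk} => [[|[|//]] ?].
  by case/orP => /eqP kE; rewrite zk kE eqxx in z0 z1.
rewrite (D_prod _ _ H2)/=; last by rewrite inE xy.
rewrite big_cons big_seq1.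
have P2 z : particles x z = (delta (x ord0) z + delta (x ord_max) z)%N.
  rewrite /particles big_ord_recl big_ord1; congr (_ + delta (x _) _)%N.
  exact: val_inj.
rewrite !P2 /delta !eqxx (negbTE xy) eq_sym (negbTE xy) /odd_dfact.
by rewrite addn0 add0n !big_ord1 muln0 add0n !divr1.
Qed.

(** Only n = 2 is used: [D (delta z)] is the square of the coordinate at [z], and [D_pair_le] passes
    from the two-particle polynomial to the product of squares. *)
Lemma moment_inequality_positively_correlated :
  (forall n (x : 'I_n -> S), (1 <= n)%N ->
     \prod_(i < n) \int[mu]_eta 'E_(Pr eta)[D (delta (x i)) \o eta_ t]
     <= \int[mu]_eta 'E_(Pr eta)[D (particles x) \o eta_ t]) ->
  positively_correlated (law_at bmp mu t) (fun x eta => (eta x ^+ 2)%R).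
Proof.
move=> HM i j.
have msq x : measurable_fun [set: conf R S] (fun eta : conf R S => (eta x ^+ 2)%R).
  by apply: measurable_funX; exact: measurable_coord.
have H : 'E_(law_at bmp mu t)[fun eta => (eta i ^+ 2)%R] *
    'E_(law_at bmp mu t)[fun eta => (eta j ^+ 2)%R] <=
    'E_(law_at bmp mu t)[fun eta => (eta i ^+ 2 * eta j ^+ 2)%R].
  rewrite !expectation_law_at//; first last.
  - by move=> eta; exact: sqr_ge0.
  - by move=> eta; exact: sqr_ge0.
  - by move=> eta; rewrite mulr_ge0// sqr_ge0.
  - exact: measurable_funM.
  pose x (k : 'I_2) := if k == ord0 then i else j.
  have := HM 2%N x isT; rewrite big_ord_recl big_ord1 /x/=.
  have DE z : D (delta z) = (fun eta : conf R S => (eta z ^+ 2)%R).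
    by apply/funext => eta; exact: D_delta.
  rewrite !DE => /le_trans; apply.
  have D0 eta : (0 <= D (particles x) eta :> R)%R.
    by apply: (@D_ge0 _ _ (codom x)) => z; exact: particles_notin.
  have mD : measurable_fun [set: conf R S] (D (particles x) : conf R S -> R).
    by apply: (@measurable_D _ _ (codom x)) => z; exact: particles_notin.
  apply: ge0_le_integral => //.
  - by move=> eta _; apply: expectation_ge0 => w /=.
  - exact: measurable_expectation bmp _ _ mD D0.
  - apply: (measurable_expectation bmp) => //; first exact: measurable_funM.
    by move=> eta; rewrite mulr_ge0// sqr_ge0.
  move=> eta _; rewrite unlock; apply: ge0_le_integral => //.
  - by move=> w _; rewrite lee_fin; exact: D0.
  - by apply/measurable_EFinP; exact: measurableT_comp mD (measurable_funP (eta_ t)).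
  - apply/measurable_EFinP.
    apply: (measurableT_comp (measurable_funM (msq i) (msq j))).
    exact: measurable_funP.
  - by move=> w _; rewrite lee_fin; exact: (D_pair_le x).
split; first exact: H.
move=> Li Lj Lij; rewrite covarianceE// sube_ge0; first exact: H.
by rewrite fin_numM// expectation_fin_num.
Qed.

End PositiveCorrelation.

Theorem mainTheorem6 (R : realType) (s : site_space)
    (p : sites s -> sites s -> R) (hp : admissible p)
    (dO : measure_display) (Omega : measurableType dO)
    (Pr : conf R (sites s) -> probability Omega R)
    (eta_ : R -> {mfun Omega >-> conf R (sites s)})
    (X0 : set (conf R (sites s)))
    (bmp : BMP Pr eta_ p X0)
    (rho : sites s -> R) (rho_ge0 : forall x, 0 <= rho x)
    (mu_rho : probability (conf R (sites s)) R)
    (hmu : product_gaussian rho mu_rho)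
    (hX0 : mu_rho X0 = 1%E) :
  forall t : R, 0 < t ->
  (forall (n : nat) (x : 'I_n -> sites s), (1 <= n)%N ->
     (\prod_(i < n) \int[mu_rho]_eta 'E_(Pr eta)[D (delta (x i)) \o eta_ t]
      <= \int[mu_rho]_eta 'E_(Pr eta)[D (particles x) \o eta_ t])%E) /\
  positively_correlated (law_at bmp mu_rho t)
    (fun (x : sites s) (eta : conf R (sites s)) => eta x ^+ 2).
Proof.
move=> t t0; have [nb [nbu nbs nbS]] := neighbours_exist hp.
have [hw _] := hp.
have HM n (x : 'I_n -> sites s) :=
  moment_inequality bmp (walk_sym hw) (walk_ge0 hw) (walk_diag hw) nbu nbs nbS
    rho_ge0 hmu hX0 (ltW t0) x.
split; first by move=> n x _; exact: HM.
by apply: moment_inequality_positively_correlated => n x _; exact: HM.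
Qed.
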